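(* Let $k/\mathbb{Q}$ be a Galois CM extension with group $G$, $p$ a prime, fix an embedding $k\subset\mathbb{C}$, and for each infinite place $v$ choose $\sigma_v\in G$ inducing $v$ after composition with $k\subset\mathbb{C}$. Let $C=T_k/\overline{\alpha_{p,\infty}(E_p(k))}^0$, where $^0$ denotes the connected component of zero of the closure, and identify its Pontrjagin dual $\hat C$ with a subgroup of $\bigoplus_{v|\infty}\mathbb{Z}$ via the isomorphism $\bigoplus_{v|\infty}\mathbb{Z}\cong\hat T_k$, $\mu\mapsto\chi_\mu$, $\chi_\mu(t)=\prod_{v|\infty}\exp(\mu_v\,\sigma_v t_v)$. Then $$\hat C=\Big\{\mu\in\bigoplus_{v|\infty}\mathbb{Z}:\ \langle\mu,\varepsilon_{\mathfrak{p},\mathfrak{p}'}\rangle=0\text{ for all }\mathfrak{p},\mathfrak{p}'\in S\Big\}.$$ Moreover $\dim\overline{\alpha_{p,\infty}(E_p(k))}$ equals the dimension of the $\mathbb{Q}$-span of the elements $\varepsilon_{\mathfrak{p},\mathfrak{p}'}$, $\mathfrak{p},\mathfrak{p}'\in S$, in $\bigoplus_{v|\infty}\mathbb{Q}$. In particular, $\alpha_{p,\infty}(E_p(k))$ is dense in $T_k$ if $p$ is completely decomposed in $k$.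
   Context: $E_p(k)$ is the group of $x\in k^*$ with $\|x\|_v=1$ for all places $v\nmid p$ (including infinite places). $c$ is complex conjugation on $k$. All infinite places $v$ are complex; $\mathbb{R}(1)_v=\{z\in k_v:\mathrm{Re}\,z=0\}$, $\mathbb{Z}(1)_v$ the image of $2\pi i\mathbb{Z}$ in $k_v$; $T_k=\bigoplus_{v|\infty}\mathbb{R}(1)_v/\mathbb{Z}(1)_v$, a real torus of dimension $\frac12[k:\mathbb{Q}]$, and $\alpha_{p,\infty}:E_p(k)\to T_k$, $x\mapsto(\log_v x_v)_{v|\infty}$ with $\log_v$ the complex logarithm. In $\chi_\mu$, $\sigma_v$ denotes the isomorphism $\mathbb{R}(1)_v/\mathbb{Z}(1)_v\to i\mathbb{R}/2\pi i\mathbb{Z}$ induced by $\sigma_v:k_v\cong\mathbb{C}$. ${\mathcal T}$ is the set of primes $\mathfrak{p}\mid p$ of $k$ with $\mathfrak{p}^c\neq\mathfrak{p}$, and $S\subset{\mathcal T}$ a system of representatives of ${\mathcal T}$ under complex conjugation. For $\mathfrak{p},\mathfrak{p}'\in{\mathcal T}$, $\varepsilon_{\mathfrak{p},\mathfrak{p}'}\in\bigoplus_{v|\infty}\mathbb{Q}$ is the function on infinite places with $\varepsilon_{\mathfrak{p},\mathfrak{p}'}(v)=1$ if $\sigma_v\mathfrak{p}=\mathfrak{p}'$, $=-1$ if $\sigma_v\mathfrak{p}=c\mathfrak{p}'$, and $=0$ otherwise. $\langle\sum a_v v,\sum b_v v\rangle=\sum a_vb_v$. *)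

(* Defs.v *)
From HB Require Import structures.
From mathcomp Require Import all_boot all_order all_algebra all_field.
From mathcomp Require Import all_classical all_reals.
From mathcomp Require Import topology normedtype trigo.
From mathcomp.real_closed Require Import complex.

Set Implicit Arguments.
Unset Strict Implicit.
Unset Printing Implicit Defensive.

Import Order.TTheory GRing.Theory Num.Theory.
Local Open Scope classical_set_scope.
Local Open Scope ring_scope.

HB.instance Definition _ (R : rcfType) :=
  PseudoPointedMetric.copy R[i] (R[i] : numClosedFieldType)^o.

Section NumberField.
Variable L : splittingFieldType rat.

Definition integral (x : L) : Prop :=
  exists q : {poly int}, q \is monic /\ root (map_poly (fun z : int => z%:~R) q) x.

Definition prime_ideal (P : set L) : Prop :=
  [/\ (forall x, P x -> integral x), P 0,
      (forall x y, P x -> P y -> P (x + y)),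
      (forall a x, integral a -> P x -> P (a * x)) &
      (~ P 1 /\
       forall a b, integral a -> integral b -> P (a * b) -> P a \/ P b)].

Definition finite_prime (P : set L) : Prop :=
  prime_ideal P /\ exists x, P x /\ x != 0.

Definition prime_over (p : nat) (P : set L) : Prop :=
  finite_prime P /\ P p%:R.

(* |x|_Q = 1 for the finite place Q: x is a unit of the local ring (O_k)_Q *)
Definition unit_at (Q : set L) (x : L) : Prop :=
  exists a b, [/\ integral a, integral b, ~ Q a, ~ Q b & x = a / b].

Definition gact (g : gal_of {:L}) (P : set L) : set L := (fun a => g a) @` P.

Definition completely_decomposed (p : nat) : Prop :=
  exists f : 'I_(\dim {:L}) -> set L,
    [/\ injective f, (forall i, prime_over p (f i)) &
        (forall P, prime_over p P -> exists i, P = f i)].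

Section Complex.
Variable R : realType.

Definition totally_real (K : {subfield L}) : Prop :=
  forall tau : {rmorphism L -> R[i]}, forall x, x \in K -> 'Im (tau x) = 0.

Definition totally_imaginary : Prop :=
  forall tau : {rmorphism L -> R[i]}, exists x, 'Im (tau x) != 0.

Definition is_CM : Prop :=
  totally_imaginary /\
  exists K : {subfield L}, \dim_K {:L} = 2%N /\ totally_real K.

Definition Ep (p : nat) : set L :=
  [set x | [/\ x != 0,
     (forall Q, finite_prime Q -> ~ Q p%:R -> unit_at Q x) &
     (forall tau : {rmorphism L -> R[i]}, `|tau x| = 1)]].

Variable I : finType. (* index set of the infinite places *)

(* The torus T_k, realised inside C^I (product topology) via
   R(1)_v/Z(1)_v --sigma_v--> iR/2 pi i Z --exp--> S^1. *)
Definition Tspace := {ptws I -> R[i]}.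
Definition Tk : set Tspace := [set z | forall v, `|z v| = 1].

Definition alpha_img (iota : {rmorphism L -> R[i]}) (sigma : I -> gal_of {:L})
  (p : nat) : set Tspace :=
  [set (fun v => iota (sigma v x) : R[i]) | x in Ep p].

Definition chi (mu : I -> int) (z : Tspace) : R[i] := \prod_v (z v) ^ (mu v).

(* exponential map of the torus, (+)_v R(1)_v -> T_k, in the coordinates
   t_v in R (t_v <-> i t_v in iR) *)
Definition texp (t : {ffun I -> R^o}) : Tspace :=
  fun v => Complex (cos (t v)) (sin (t v)).

(* dimension of a closed subgroup H of T_k: dimension of its Lie algebra
   {t | exp(s t) in H for all real s} *)
Definition subgroup_dim (H : set Tspace) (d : nat) : Prop :=
  exists W : {vspace {ffun I -> R^o}},
    (forall t, t \in W <-> forall s : R, H (texp (s *: t))) /\ \dim W = d.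

End Complex.

Definition eps (I : finType) (sigma : I -> gal_of {:L}) (c : gal_of {:L})
  (P P' : set L) (v : I) : int :=
  if `[< gact (sigma v) P = P' >] then 1
  else if `[< gact (sigma v) P = gact c P' >] then -1 else 0.

Definition qspan_dim (vT : vectType rat) (X : set vT) (d : nat) : Prop :=
  exists s : seq vT, [/\ (forall x, x \in s -> X x),
                         (forall x, X x -> x \in <<s>>%VS) &
                         \dim <<s>>%VS = d].

End NumberField.

(* Main.v *)
(* Write [v_P] for the valuation of a finite prime [P].  The norms of [x] in
   [E_p] at the infinite places being 1, [x * c x = 1], so that [v_{cP} x = - v_P x]
   and [x] is determined up to a root of unity by the [v_P x], [P] in [S].  Since
   [v_{P'} (prod_v sigma_v(x)^mu_v) = sum_P v_P x * <mu, eps_{P,P'}>], the character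
   [chi_mu] has finite order on [E_p] as soon as [mu] is orthogonal to all
   [eps_{P,P'}]; hence it is trivial on the component [H0].

   Conversely, finiteness of the class number gives [y] with [v_P y > 0] and
   [v_Q y = 0] for [Q <> P], and [x = y / c y] lies in [E_p].  A character trivial
   on [x] is orthogonal to [eps_{P,P'}] for all [P'], so by Kronecker's theorem the
   closure of the powers of [x] contains the one-parameter subgroups directed by
   the [eps_{P,P'}].  These span the Lie algebra of [H] over the reals. *)

Require Import Defs.
From HB Require Import structures.
From mathcomp Require Import all_boot all_order all_algebra all_field.
From mathcomp Require Import all_classical all_reals.
From mathcomp Require Import topology normedtype trigo.
From mathcomp.real_closed Require Import complex.
From mathcomp Require Import zify ring lra.
Set Implicit Arguments.
Unset Strict Implicit.
Unset Printing Implicit Defensive.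
Import Order.TTheory GRing.Theory Num.Theory.
Local Open Scope classical_set_scope.
Local Open Scope ring_scope.

(** * The topology of the torus *)

Section Torus.
Variables (R : realType) (I : finType).
Notation C := R[i].
Notation T := (Tspace R I).

(** What ties places to primes is that [c] is central in the Galois group of a CM field: norm 1 at
    all infinite places becomes the single equation [x * c x = 1], and a prime fixed by [c] has
    valuation 0 on E_p.

    Finite order has to be uniform. The integers all of whose conjugates have norm 1 form a finite
    set, so one exponent [N] serves for all of E_p, and [chi_mu ^ N = 1] passes to the closure. A
    multiple of [mu] is thus trivial on [H], while [mu] itself is in general trivial only on the
    component, where a continuous function with values in the [N]-th roots of unity is constant.

    For the dimension, a real vector of the Lie algebra is killed by every integer vector orthogonal
    to the eps. Their orthogonal complement is defined over the rationals, so the vector lies in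
    their real span, and a rational basis stays free over the reals.

    When p is completely decomposed, the Galois group acts freely on the primes over p, and each
    coordinate vector is up to sign one of the eps. *)

Lemma nbhs_complexP (x : C) (U : set C) :
  nbhs x U <-> exists2 e : C, 0 < e & forall y, `|x - y| < e -> U y.
Proof.
split=> [/nbhs_ballP[e /= e0 h]|[e e0 h]]; first by exists e.
by apply/nbhs_ballP; exists e.
Qed.

(** As [I] is finite, one radius serves for all coordinates; all later estimates use boxes instead
    of the product topology. *)
Lemma nbhs_boxP (z : T) (U : set T) :
  nbhs z U <-> exists2 e : C, 0 < e & forall w : T, (forall v, `|z v - w v| < e) -> U w.
Proof.
split=> [zU|[e e0 h]]; last first.
  have : \forall w \near z, forall v, `|z v - w v| < e.
    apply: (@filter_forall T I (fun v => [set w : T | `|z v - w v| < e]) (nbhs z)) => v.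
    apply: (@proj_continuous I (fun _ => C) v z [set y | `|z v - y| < e]).
    by apply/nbhs_complexP; exists e.
  by move=> hw; apply: (@filterS _ _ (nbhs_filter z) _ _ _ hw) => w; apply: h.
(* The supersets of boxes around [z] form a filter that converges to [z] in each coordinate, hence
   in the product topology. *)
pose F : set_system T := [set U | exists2 e : C, 0 < e &
   forall w : T, (forall v, `|z v - w v| < e) -> U w].
have FF : Filter F.
  split.
  - by exists 1.
  - move=> P Q [e e0 he] [f f0 hf].
    have ef : e >=< f by rewrite real_comparable ?gtr0_real.
    exists (Num.min e f); first by rewrite comparable_lt_min // e0 f0.
    move=> w hw; split; [apply: he|apply: hf] => v; have := hw v;
    by rewrite comparable_lt_min // => /andP[].
  - by move=> P Q PQ [e e0 he]; exists e => // w /he /PQ.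
suff : F --> z by apply.
apply/cvg_sup => v.
rewrite cvg_image; last by rewrite eqEsubset; split=> x // _; exists (fun _ => x).
move=> W /= /nbhs_complexP[e e0 eW].
exists ((fun w : T => w v) @^-1` W).
  by exists e => // w hw; apply: eW.
by rewrite eqEsubset; split => [j [? + <-//]|j Wj]; exists (fun _ => j).
Qed.

Lemma closure_boxP (A : set T) (z : T) :
  closure A z <-> forall e : C, 0 < e -> exists2 b, A b & forall v, `|z v - b v| < e.
Proof.
split=> [Az e e0|h B /nbhs_boxP[e e0 eB]].
  have [|b [Ab hb]] := Az [set w | forall v, `|z v - w v| < e].
    by apply/nbhs_boxP; exists e.
  by exists b.
by have [b Ab hb] := h e e0; exists b; split=> //; apply: eB.
Qed.

(** The radius [e] is the same at every point, so the level set of [f] through [z] is both open and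
    closed in [A]. *)
Lemma connected_locally_constant (X : Type) (A : set T) (f : T -> X) (e : C) :
  connected A -> 0 < e ->
  (forall z w, A z -> A w -> (forall v, `|z v - w v| < e) -> f z = f w) ->
  forall z w, A z -> A w -> f z = f w.
Proof.
move=> cA e0 lc z w Az Aw.
pose B := [set u | A u /\ f u = f z].
suff BA : B = A by have [] : B w by rewrite BA.
apply: cA.
- by exists z.
- exists (interior [set u | A u -> f u = f z]); first exact: open_interior.
  apply/seteqP; split=> u /=.
    move=> [Au fu]; split => //; apply/nbhs_boxP; exists e => // u' hu Au'.
    by rewrite -fu; apply: lc => // v; rewrite distrC.
  by move=> [Au /interior_subset /(_ Au)].
- exists (closure B); first exact: closed_closure.
  apply/seteqP; split=> u /=.
    by move=> Bu; split; [case: Bu|apply: subset_closure].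
  move=> [Au /closure_boxP/(_ e e0) [b [Ab fb] hb]]; split => //.
  by rewrite -fb; apply: lc.
Qed.

Lemma dist_prod_le (J : Type) (r : seq J) (a b : J -> C) :
  (forall j, `|a j| = 1) -> (forall j, `|b j| = 1) ->
  `|\prod_(j <- r) a j - \prod_(j <- r) b j| <= \sum_(j <- r) `|a j - b j|.
Proof.
move=> a1 b1; elim: r => [|j r IH]; first by rewrite !big_nil subrr normr0.
rewrite !big_cons.
have -> : a j * \prod_(i <- r) a i - b j * \prod_(i <- r) b i =
  (a j - b j) * \prod_(i <- r) a i + b j * (\prod_(i <- r) a i - \prod_(i <- r) b i) by ring.
apply: le_trans (ler_normD _ _) _; rewrite !normrM b1 mul1r lerD //.
by rewrite normr_prod big1 ?mulr1.
Qed.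

Lemma dist_exprz_le (a b : C) (n : int) : `|a| = 1 -> `|b| = 1 ->
  `|a ^ n - b ^ n| <= `|n|%N%:R * `|a - b|.
Proof.
move=> a1 b1.
have nat_case k : `|a ^+ k - b ^+ k| <= k%:R * `|a - b|.
  have /= := @dist_prod_le _ (index_enum 'I_k) (fun=> a) (fun=> b) (fun=> a1) (fun=> b1).
  by rewrite !prodr_const sumr_const card_ord mulr_natl.
case: n => n; first exact: nat_case.
rewrite NegzE -!invr_expz abszN absz_nat -!exprnP.
have a0 : a ^+ n.+1 != 0 by rewrite -normr_eq0 normrX a1 expr1n oner_eq0.
have b0 : b ^+ n.+1 != 0 by rewrite -normr_eq0 normrX b1 expr1n oner_eq0.
have -> : (a ^+ n.+1)^-1 - (b ^+ n.+1)^-1 = (b ^+ n.+1 - a ^+ n.+1) / (a ^+ n.+1 * b ^+ n.+1).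
  by field; rewrite a0 b0.
by rewrite normrM normfV normrM !normrX a1 b1 !expr1n mulr1 invr1 mulr1 distrC; apply: nat_case.
Qed.

Lemma norm_exprz1 (a : C) (n : int) : `|a| = 1 -> `|a ^ n| = 1.
Proof. by move=> a1; case: n => n; rewrite ?NegzE /exprz /= ?normfV normrX a1 expr1n ?invr1. Qed.

Lemma dist_chi_le (mu : I -> int) (z w : T) : Tk z -> Tk w ->
  `|chi mu z - chi mu w| <= \sum_v `|mu v|%N%:R * `|z v - w v|.
Proof.
move=> z1 w1; apply: le_trans (dist_prod_le _ _ _) _; try by move=> v; rewrite norm_exprz1.
by apply: ler_sum => v _; apply: dist_exprz_le.
Qed.

Lemma dist_chi_lt (mu : I -> int) (e : C) : 0 < e -> exists2 d : C, 0 < d &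
  forall z w : T, Tk z -> Tk w -> (forall v, `|z v - w v| < d) -> `|chi mu z - chi mu w| < e.
Proof.
move=> e0; pose K : C := \sum_v `|mu v|%N%:R + 1.
have K0 : 0 < K by rewrite ltr_wpDl ?sumr_ge0.
exists (e / K); first by rewrite divr_gt0.
move=> z w z1 w1 zw; apply: le_lt_trans (dist_chi_le _ z1 w1) _.
apply: le_lt_trans (_ : (\sum_v `|mu v|%N%:R) * (e / K) < _).
  by rewrite mulr_suml; apply: ler_sum => v _; rewrite ler_wpM2l // ltW.
by rewrite mulrCA gtr_pMr // ltr_pdivrMr // mul1r /K ltrDl.
Qed.

(** If [u] is not 1, its first [N] powers sum to 0, so [N] is the norm of the sum of the
    [1 - u ^+ i], each of norm at most [N] times that of [u - 1]. *)
Lemma root_of_unity_gap (N : nat) (u : C) : (0 < N)%N -> `|u| = 1 -> u ^+ N = 1 ->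
  `|u - 1| * N%:R < 1 -> u = 1.
Proof.
case: N => // N _ u1 uN gap; apply/eqP; apply: contraTT gap => un1.
have : (u - 1) * \sum_(i < N.+1) u ^+ i = 0 by rewrite -subrX1 uN subrr.
move/eqP; rewrite mulf_eq0 subr_eq0 (negPf un1) /= => /eqP s0.
have : N.+1%:R <= \sum_(i < N.+1) N.+1%:R * `|u - 1|.
  apply: le_trans (_ : `|\sum_(i < N.+1) (1 - u ^+ i)| <= _).
    by rewrite sumrB s0 subr0 sumr_const card_ord ger0_norm.
  apply: le_trans (ler_norm_sum _ _ _) _; apply: ler_sum => i _.
  have := @dist_exprz_le 1 u i (normr1 _) u1; rewrite exp1rz => h; apply: le_trans h _.
  by rewrite distrC absz_nat ler_wpM2r // ler_nat; apply/ltnW/ltn_ord.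
rewrite sumr_const card_ord -[leRHS]mulr_natl -[leLHS]mulr1 ler_pM2l ?ltr0n // => h.
by apply/negP; rewrite mulrC => /(le_lt_trans h); rewrite ltxx.
Qed.

Lemma closure_Tk (A : set T) : A `<=` @Tk R I -> closure A `<=` @Tk R I.
Proof.
move=> AT z /closure_boxP Az v; apply/eqP; rewrite -subr_eq0 -normr_le0.
apply/ler_addgt0Pr => e e0; rewrite add0r.
have [b /AT b1 /(_ v) zb] := Az e e0.
rewrite -(b1 v); exact: le_trans (ler_dist_dist _ _) (ltW zb).
Qed.

Lemma closure_chi1 (A : set T) mu : A `<=` @Tk R I ->
  (forall z, A z -> chi mu z = 1) -> forall z, closure A z -> chi mu z = 1.
Proof.
move=> AT A1 z Az; apply/eqP; rewrite -subr_eq0 -normr_le0.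
apply/ler_addgt0Pr => e e0; rewrite add0r.
have [d d0 hd] := dist_chi_lt mu e0.
have /closure_boxP/(_ d d0)[b Ab zb] := Az.
rewrite -(A1 b) //; apply/ltW/hd => //; [exact: closure_Tk Az|exact: AT].
Qed.

Lemma closure_mul (A : set T) : A `<=` @Tk R I ->
  (forall z w, A z -> A w -> A (fun v => z v * w v)) ->
  forall z w, closure A z -> closure A w -> closure A (fun v => z v * w v : C).
Proof.
move=> AT AM z w Az Aw; apply/closure_boxP => e e0.
have e2 : 0 < e / 2 by rewrite divr_gt0.
have /closure_boxP/(_ _ e2)[b Ab zb] := Az.
have /closure_boxP/(_ _ e2)[c Ac wc] := Aw.
exists (fun v => b v * c v); first exact: AM.
move=> v; have w1 := closure_Tk AT Aw v; have b1 := AT _ Ab v.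
have -> : z v * w v - b v * c v = (z v - b v) * w v + b v * (w v - c v) by ring.
apply: le_lt_trans (ler_normD _ _) _; rewrite !normrM w1 b1 mulr1 mul1r.
by rewrite (splitr e) ltrD.
Qed.
End Torus.

(** * Kronecker's approximation theorem *)

(** The [2m + 1] binomial coefficients of order [2m] sum to [4 ^ m] and the central one is the
    largest. The bound says that the constant term of the kernel used below decays only like
    [1 / (2m + 1)]. *)
Lemma central_bin_ge m : (4 ^ m <= (m.*2).+1 * 'C(m.*2, m))%N.
Proof.
elim: m => [//|m IH].
have e1 := mul_bin_diag (m.*2).+2 m.
have e2 := mul_bin_diag (m.*2).+1 m.
have e3 : 'C(m.*2.+1, m.+1) = 'C(m.*2.+1, m).
  rewrite -[RHS]bin_sub; last by lia.
  by congr 'C(_, _); lia.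
rewrite /= in e1 e2; rewrite e3 in e2.
rewrite expnS doubleS.
have : (m.+1 * (4 * 4 ^ m) <= m.+1 * (m.*2.+3 * 'C(m.*2.+2, m.+1)))%N.
  rewrite [leqRHS]mulnCA -e1.
  have -> : (m.*2.+2 * 'C(m.*2.+1, m) = 2 * (m.+1 * 'C(m.*2.+1, m)))%N by rewrite mulnA; congr muln; lia.
  rewrite -e2 mulnA (mulnC _ (2 * _)%N) -mulnA.
  apply: leq_trans (_ : (m.+1 * 4) * (m.*2.+1 * 'C(m.*2, m)) <= _)%N.
    by rewrite mulnA leq_mul2l IH orbT.
  by move: (_.+1 * 'C(_, _))%N => u; nia.
by rewrite leq_pmul2l.
Qed.

Section Kronecker.
Variable R : realType.
Notation C := R[i].

Lemma complex_archi (x : C) : 0 <= x -> exists n : nat, x < n%:R.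
Proof.
case: x => a b; rewrite lecE /= => /andP[/eqP b0 a0].
exists (Num.truncn a).+1; rewrite b0.
have -> : (((Num.truncn a).+1)%:R : C) = Complex ((Num.truncn a).+1%:R) 0.
  by rewrite -[LHS](rmorph_nat (real_complex R)).
by rewrite ltcE /= eqxx /=; apply: truncnS_gt.
Qed.

Lemma unit_conj_inv (w : C) : `|w| = 1 -> w^-1 = w^*.
Proof.
move=> w1; have w0 : w != 0 by rewrite -normr_eq0 w1 oner_eq0.
by rewrite invC_norm w1 expr1n invr1 mul1r.
Qed.

(** For [w = exp(i theta)] both sides are the squared cosine of [theta / 2]: a Laurent polynomial in
    [w] with values between 0 and 1, equal to 1 only at [w = 1]. *)
Lemma cosine_weight (w : C) : `|w| = 1 -> (2 + w + w^-1) / 4 = 1 - `|w - 1| ^+ 2 / 4.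
Proof.
move=> w1; have w0 : w != 0 by rewrite -normr_eq0 w1 oner_eq0.
have -> : `|w - 1| ^+ 2 = (w - 1) * (w^-1 - 1).
  by rewrite normCK rmorphB rmorph1 /= unit_conj_inv.
by field; rewrite w0.
Qed.

Lemma cosine_weight_expand (w : C) m : w != 0 ->
  ((2 + w + w^-1) / 4) ^+ m =
  \sum_(k < m.*2.+1) ('C(m.*2, k)%:R / 4 ^+ m) * w ^ (k%:Z - m%:Z).
Proof.
move=> w0.
have -> : (2 + w + w^-1) / 4 = (1 + w) ^+ 2 / (4 * w) by field; rewrite w0.
rewrite expr_div_n -exprM mulnC -muln2 muln2 exprDn mulr_suml.
rewrite (eq_bigl xpredT) //; apply: eq_bigr => k _.
rewrite expr1n mul1r expfzDr // -exprnN -exprnP exprMn invfM -mulr_natl.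
by move: (w ^+ k) (w ^- m) (4 ^- m) ('C(_, _)%:R) => x y z t; ring.
Qed.

Lemma geometric_sum_bound (r : C) N : `|r| = 1 -> r != 1 ->
  `|\sum_(n < N) r ^+ n| <= 2 / `|1 - r|.
Proof.
move=> r1 rn1.
have d0 : 1 - r != 0 by rewrite subr_eq0 eq_sym.
rewrite ler_pdivlMr ?normr_gt0 // -normrM mulrC -opprB mulNr -subrX1 normrN.
by apply: le_trans (ler_normB _ _) _; rewrite normrX r1 expr1n normr1.
Qed.

Lemma poly_lt_exp (d : nat) (q : C) : 0 <= q -> q < 1 ->
  exists m : nat, (m.*2.+1)%:R ^+ d * q ^+ m < 1.
Proof.
move=> q0 q1.
have [q00|qN0] := eqVneq q 0.
  by exists 1%N; rewrite q00 expr1 mulr0 ltr01.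
have qp : 0 < q by rewrite lt_def qN0.
pose s := q^-1 - 1.
have sp : 0 < s by rewrite subr_gt0 invf_gt1.
pose D : C := (2 * d.+1)%:R / s + 1.
have D1 : 0 < D by rewrite ltr_wpDl // divr_ge0 // ltW.
have [k kD] : exists k : nat, D ^+ d / s < k%:R.
  by apply: complex_archi; rewrite divr_ge0 // ltW // exprn_gt0.
(* By Bernoulli, [(1 + s) ^ m] is at least [(1 + k s) ^ (d + 1)]: [d] of these factors absorb
   [2m + 1 <= D (1 + k s)], and the last one exceeds [D ^ d] by the choice of [k]. *)
exists (k * d.+1)%N.
have qE : q = (1 + s)^-1 by rewrite /s addrC subrK invrK.
have s1 : 0 < 1 + s by rewrite addr_gt0.
rewrite qE exprVn ltr_pdivrMr ?exprn_gt0 // mul1r.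
have ks0 : 0 <= 1 + k%:R * s by rewrite addr_ge0 // mulr_ge0 // ltW.
have bern : 1 + k%:R * s <= (1 + s) ^+ k.
  elim: (k) => [|n IH]; first by rewrite mul0r addr0 expr0.
  rewrite exprSr; apply: le_trans (_ : (1 + n%:R * s) * (1 + s) <= _); last first.
    by rewrite ler_pM2r.
  rewrite -natr1 -subr_ge0.
  have -> : (1 + n%:R * s) * (1 + s) - (1 + (n%:R + 1) * s) = n%:R * s ^+ 2 by ring.
  by rewrite mulr_ge0 // exprn_ge0 // ltW.
have step : ((k * d.+1).*2.+1)%:R <= D * (1 + k%:R * s).
  rewrite -subr_ge0 -muln2.
  have -> : D * (1 + k%:R * s) - (k * d.+1 * 2).+1%:R = (2 * d.+1)%:R / s + k%:R * s.
    rewrite /D -[in X in _ - X]natr1 !natrM.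
    by field; rewrite gt_eqF.
  by rewrite addr_ge0 // ?divr_ge0 ?mulr_ge0 // ltW.
apply: le_lt_trans (_ : (D * (1 + k%:R * s)) ^+ d < _).
  by rewrite lerXn2r // ?nnegrE ?mulr_ge0 // ltW.
rewrite exprMn exprM.
apply: lt_le_trans (_ : (1 + k%:R * s) ^+ d.+1 <= _); last first.
  by rewrite lerXn2r ?nnegrE // (le_trans ks0).
rewrite exprS ltr_pM2r; last by rewrite exprn_gt0 // (lt_le_trans ltr01) // lerDl mulr_ge0 // ltW.
rewrite ltr_pdivrMr // in kD.
by apply: lt_le_trans kD _; rewrite lerDr.
Qed.

Section Approximation.
Variables (I : finType) (a z0 : Tspace R I).
Hypotheses (a1 : forall v, `|a v| = 1) (z1 : forall v, `|z0 v| = 1).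

Lemma unit_neq0 (w : C) : `|w| = 1 -> w != 0.
Proof. by move=> w1; rewrite -normr_eq0 w1 oner_eq0. Qed.

Lemma chi_norm (mu : I -> int) (z : Tspace R I) :
  (forall v, `|z v| = 1) -> `|chi mu z| = 1.
Proof.
move=> h; rewrite /chi normr_prod big1 // => v _.
by case: (mu v) => n; rewrite ?NegzE /exprz /= ?normfV normrX h expr1n ?invr1.
Qed.

Let w n v := a v ^+ n / z0 v.
Let F m n := \prod_v ((2 + w n v + (w n v)^-1) / 4) ^+ m.

Let w1 n v : `|w n v| = 1.
Proof. by rewrite /w normrM normfV normrX a1 z1 expr1n invr1 mulr1. Qed.

Let weight_ge0 n v : 0 <= (2 + w n v + (w n v)^-1) / 4.
Proof.
rewrite cosine_weight ?w1 // subr_ge0 ler_pdivrMr // mul1r.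
have -> : (4 : C) = 2 ^+ 2 by rewrite -natrX.
rewrite lerXn2r ?nnegrE // (le_trans (ler_normB _ _)) // w1 normr1.
by rewrite -(natrD _ 1 1).
Qed.

Let weight_le1 n v : (2 + w n v + (w n v)^-1) / 4 <= 1.
Proof. by rewrite cosine_weight ?w1 // lerBlDr lerDl divr_ge0 // exprn_ge0. Qed.

Let shift m (f : {ffun I -> 'I_(m.*2.+1)}) v : int := (f v)%:Z - m%:Z.
Let coef m (f : {ffun I -> 'I_(m.*2.+1)}) : C := \prod_v ('C(m.*2, f v)%:R / 4 ^+ m).

Let F_expand m n : F m n =
  \sum_(f : {ffun I -> 'I_(m.*2.+1)}) coef f * (chi (shift f) a ^+ n / chi (shift f) z0).
Proof.
rewrite /F (eq_bigr (fun v => \sum_(k < m.*2.+1)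
    ('C(m.*2, k)%:R / 4 ^+ m) * (w n v) ^ (k%:Z - m%:Z))); last first.
  by move=> v _; rewrite cosine_weight_expand // unit_neq0.
rewrite bigA_distr_bigA /=; apply: eq_bigr => f _.
rewrite big_split /=; congr (_ * _).
rewrite /chi -prodrXl -prodf_div; apply: eq_bigr => v _.
by rewrite /w /shift expfzMl exprz_inv -invr_expz; congr (_ * _); rewrite !exprnP exprzAC.
Qed.

Let coef_ge0 m (f : {ffun I -> 'I_(m.*2.+1)}) : 0 <= coef f.
Proof. by apply: prodr_ge0 => v _; rewrite divr_ge0 // exprn_ge0. Qed.

(* Kronecker's approximation theorem, by averaging the positive trigonometric
   polynomial [F m] along the orbit: the resonant characters contribute
   positively, at least [(2m+1)^-|I|], the others stay bounded, while [F m]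
   would be exponentially small in [m] if the orbit of [a] avoided a
   neighbourhood of [z0]. *)
Lemma kronecker_approximation (e : C) : 0 < e ->
  (forall mu : I -> int, chi mu a = 1 -> chi mu z0 = 1) ->
  exists n : nat, forall v, `|a v ^+ n - z0 v| < e.
Proof.
move=> e0 res; apply: contrapT => /forallNP far.
have {}far n : exists v, e <= `|w n v - 1|.
  have /existsNP [v hv] := far n; exists v.
  have -> : `|w n v - 1| = `|a v ^+ n - z0 v|.
    have zN0 := unit_neq0 (z1 v).
    have -> : w n v - 1 = (a v ^+ n - z0 v) / z0 v by rewrite /w mulrBl divff.
    by rewrite normrM normfV z1 invr1 mulr1.
  by rewrite real_leNgt ?normr_real ?gtr0_real //; apply/negP.
have e2 : e ^+ 2 / 4 <= 1.
  have [v hv] := far 0%N; have := weight_ge0 0 v.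
  rewrite cosine_weight ?w1 // subr_ge0; apply: le_trans.
  by rewrite ler_pM2r ?invr_gt0 // lerXn2r ?nnegrE // ltW.
pose q : C := 1 - e ^+ 2 / 4.
have q0 : 0 <= q by rewrite subr_ge0.
have q1 : q < 1 by rewrite ltrBlDr ltrDl divr_gt0 // exprn_gt0.
have Fq m n : F m n <= q ^+ m.
  have [v hv] := far n.
  rewrite /F (bigD1 v) //= -[leRHS]mulr1 ler_pM ?exprn_ge0 //.
  - by apply: prodr_ge0 => u _; rewrite exprn_ge0.
  - rewrite lerXn2r ?nnegrE // cosine_weight ?w1 // lerB // ler_pM2r ?invr_gt0 //.
    by rewrite lerXn2r ?nnegrE // ltW.
  - by apply: prodr_ile1 => u; rewrite exprn_ge0 //= exprn_ile1.
(* The zero-frequency coefficient of [F m] is a product of [#|I|] factors, each at least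
   [1 / (2m + 1)]; this [m] makes [q ^+ m] smaller than it. *)
have [m hm] := poly_lt_exp #|I| q0 q1.
(* Bounds the geometric sum of a non-resonant frequency independently of its length. At a resonant
   one the division by zero gives 0, which is harmless. *)
pose B (f : {ffun I -> 'I_(m.*2.+1)}) : C := 2 / `|1 - chi (shift f) a|.
pose K := \sum_(f : {ffun I -> 'I_(m.*2.+1)}) coef f * B f.
have B0 f : 0 <= B f by rewrite divr_ge0.
have K0 : 0 <= K by apply: sumr_ge0 => f _; rewrite mulr_ge0.
(* Frequencies are indexed with an offset of [m], so the constant [m] is the trivial character,
   always resonant. *)
pose f0 : {ffun I -> 'I_(m.*2.+1)} := [ffun=> inord m].
have mlt : (m < m.*2.+1)%N by rewrite ltnS -addnn leq_addr.
have lower N : N%:R * coef f0 - K <= \sum_(n < N) F m n.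
  pose A := \sum_(f : {ffun I -> 'I_(m.*2.+1)} | chi (shift f) a == 1) coef f * N%:R.
  pose X := \sum_(f : {ffun I -> 'I_(m.*2.+1)} | chi (shift f) a != 1)
    coef f * ((\sum_(n < N) chi (shift f) a ^+ n) / chi (shift f) z0).
  have FAX : \sum_(n < N) F m n = A + X.
    under eq_bigr => n _ do rewrite F_expand.
    rewrite exchange_big /=.
    under eq_bigr => f _ do rewrite -mulr_sumr -mulr_suml.
    rewrite (bigID (fun f => chi (shift f) a == 1)) /=; congr (_ + _).
    apply: eq_bigr => f /eqP f1; rewrite res // f1 divr1.
    by under eq_bigr => n _ do rewrite expr1n; rewrite sumr_const card_ord.
  have XK : `|X| <= K.
    apply: le_trans (ler_norm_sum _ _ _) _.
    apply: le_trans (_ : \sum_(f : {ffun I -> 'I_(m.*2.+1)} | chi (shift f) a != 1) coef f * B f <= _).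
      apply: ler_sum => f fn1; rewrite !normrM ger0_norm // ler_wpM2l //.
      rewrite normfV chi_norm // invr1 mulr1.
      by rewrite geometric_sum_bound // chi_norm.
    by rewrite [leRHS](bigID (fun f => chi (shift f) a != 1)) /= lerDl sumr_ge0 // => f _; rewrite mulr_ge0.
  have A0 : 0 <= A by apply: sumr_ge0 => f _; rewrite mulr_ge0.
  (* [X] is a sum of complex terms; only once it is known to be real does the bound on its norm give
     [- K <= X]. *)
  have Xreal : X \is Num.real.
    have -> : X = \sum_(n < N) F m n - A by rewrite FAX addrC addKr.
    rewrite rpredB ?ger0_real // sumr_ge0 // => n _.
    by apply: prodr_ge0 => v _; rewrite exprn_ge0.
  rewrite FAX lerD //; last first.
    by move: XK; rewrite real_ler_norml // => /andP[].
  rewrite /A (bigD1 f0) /=; last first.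
    by apply/eqP; rewrite /chi big1 // => v _; rewrite /shift ffunE inordK ?subrr.
  by rewrite mulrC lerDl sumr_ge0 // => f _; rewrite mulr_ge0.
have gap : 0 < coef f0 - q ^+ m.
  rewrite subr_gt0 /coef.
  under eq_bigr => v _ do rewrite ffunE inordK //.
  rewrite prodr_const.
  have h : (m.*2.+1%:R : C)^-1 <= 'C(m.*2, m)%:R / 4 ^+ m.
    rewrite ler_pdivlMr ?exprn_gt0 // mulrC ler_pdivrMr ?ltr0n //.
    by rewrite -natrX -natrM ler_nat mulnC central_bin_ge.
  apply: lt_le_trans (_ : (m.*2.+1%:R : C)^-1 ^+ #|I| <= _); last first.
    by rewrite lerXn2r ?nnegrE ?invr_ge0 // divr_ge0 // exprn_ge0.
  by rewrite exprVn -[ltRHS]mul1r ltr_pdivlMr ?exprn_gt0 ?ltr0n // mulrC.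
(* The sum over [n < N] is at least [N * coef f0 - K] and at most [N * q ^+ m], which is absurd for
   such an [N]. *)
have [N hN] : exists N : nat, K / (coef f0 - q ^+ m) < N%:R.
  by apply: complex_archi; rewrite divr_ge0 // ltW.
rewrite ltr_pdivrMr // mulrBr in hN.
have upper : \sum_(n < N) F m n <= N%:R * q ^+ m.
  have -> : N%:R * q ^+ m = \sum_(n < N) q ^+ m by rewrite sumr_const card_ord mulr_natl.
  by apply: ler_sum.
have := le_trans (lower N) upper.
rewrite lerBlDr -lerBlDl => /(lt_le_trans hN).
by rewrite ltxx.
Qed.
End Approximation.
End Kronecker.

(** * One-parameter subgroups of the torus *)

Section Exponential.
Import numFieldNormedType.Exports.
Variable R : realType.
Notation C := R[i].

Definition cis (x : R) : C := Complex (cos x) (sin x).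

Lemma cis0 : cis 0 = 1.
Proof. by rewrite /cis cos0 sin0. Qed.

Lemma cisD x y : cis (x + y) = cis x * cis y.
Proof. by rewrite /cis cosD sinD; apply/eqP; rewrite eq_complex /= eqxx addrC (mulrC (sin x)) mulrC eqxx. Qed.

Lemma norm_cis x : `|cis x| = 1.
Proof. by rewrite normc_def /= cos2Dsin2 sqrtr1. Qed.

Lemma cis_neq0 x : cis x != 0.
Proof. by rewrite -normr_eq0 norm_cis oner_eq0. Qed.

Lemma cisN x : cis (- x) = (cis x)^-1.
Proof.
by apply: (mulfI (cis_neq0 x)); rewrite -cisD subrr cis0 divff // cis_neq0.
Qed.

Lemma cisMn x n : cis (x *+ n) = cis x ^+ n.
Proof. by elim: n => [|n IH]; rewrite ?mulr0n ?cis0 // mulrS cisD IH exprS. Qed.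

Lemma cisMz x (n : int) : cis (x *~ n) = cis x ^ n.
Proof.
case: n => n; first by rewrite -pmulrn cisMn.
by rewrite NegzE mulrNz cisN -pmulrn cisMn -invr_expz -exprnP.
Qed.

Lemma cis_sum (J : Type) (r : seq J) (f : J -> R) :
  cis (\sum_(j <- r) f j) = \prod_(j <- r) cis (f j).
Proof. by apply: (big_morph cis cisD cis0). Qed.

(** Otherwise the value at [s = pi / x] would be -1. *)
Lemma cis_line_eq0 (x : R) : (forall s, cis (s * x) = 1) -> x = 0.
Proof.
move=> h; apply/eqP; apply: contraT => x0.
have := h (pi / x); rewrite divfK // => /(congr1 (@complex.Re R)) /=.
by rewrite cospi => /eqP; rewrite eq_sym -addr_eq0 -(natrD _ 1 1) pnatr_eq0.
Qed.

Lemma continuous_cis : continuous cis.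
Proof.
move=> x U /nbhs_complexP[e e0 eU].
have [f [f0 fe]] : exists f : R, 0 < f /\ (2 * f)%:C%C <= e.
  case: e e0 {eU} => a b; rewrite ltcE /= => /andP[/eqP -> a0].
  exists (a / 2); split; first by rewrite divr_gt0.
  by have -> : 2 * (a / 2) = a by rewrite mulrC divfK // pnatr_eq0.
have hc : \forall y \near x, `|cos x - cos y| < f.
  by have /cvgrPdist_lt := @continuous_cos R x; apply.
have hs : \forall y \near x, `|sin x - sin y| < f.
  by have /cvgrPdist_lt := @continuous_sin R x; apply.
change (nbhs x (cis @^-1` U)); apply: filterS (filterI hc hs) => y [cy sy].
apply: eU; apply: lt_le_trans fe.
have -> : cis x - cis y = (cos x - cos y)%:C%C + 'i%C * (sin x - sin y)%:C%C.
  by rewrite /cis; apply/eqP; rewrite eq_complex /= !mul0r !mul1r ?mulr0 ?subr0 ?addr0 ?add0r ?subrr !eqxx.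
apply: le_lt_trans (ler_normD _ _) _.
rewrite normrM normCi mul1r !normc_def /= !expr0n /= !addr0 !sqrtr_sqr -rmorphD /= ltcR.
by rewrite mulr_natl mulr2n ltrD.
Qed.

Lemma cis_surj (z : C) : `|z| = 1 -> exists x, z = cis x.
Proof.
case: z => a b; rewrite normc_def /= => /eqP; rewrite eq_complex /= eqxx andbT => /eqP n1.
have ab : a ^+ 2 + b ^+ 2 = 1.
  have ab0 : 0 <= a ^+ 2 + b ^+ 2 by rewrite addr_ge0 // sqr_ge0.
  by rewrite -(sqr_sqrtr ab0) n1 expr1n.
have a1 : -1 <= a <= 1.
  by rewrite -ler_norml -(ler_pXn2r (n := 2)) ?nnegrE // expr1n real_normK ?num_real // -ab lerDl sqr_ge0.
have [_ ca] := acos_def a1.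
have : sin (acos a) ^+ 2 == b ^+ 2.
  by apply/eqP/(addrI (cos (acos a) ^+ 2)); rewrite cos2Dsin2 ca ab.
rewrite eqf_sqr => /orP[/eqP sb|/eqP sb].
  by exists (acos a); rewrite /cis ca sb.
by exists (- acos a); rewrite /cis cosN sinN ca sb opprK.
Qed.

Variable I : finType.

Lemma texpE (t : {ffun I -> R^o}) v : texp t v = cis (t v).
Proof. by []. Qed.

Lemma texp_Tk (t : {ffun I -> R^o}) : Tk (texp t).
Proof. by move=> v; rewrite texpE norm_cis. Qed.

Lemma texp0 : texp (0 : {ffun I -> R^o}) = (fun=> 1).
Proof. by apply/funext => v; rewrite texpE ffunE cis0. Qed.

Lemma texpD (s t : {ffun I -> R^o}) : texp (s + t) = (fun v => texp s v * texp t v).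
Proof. by apply/funext => v; rewrite !texpE ffunE cisD. Qed.

Lemma chi_texp mu (t : {ffun I -> R^o}) :
  chi mu (texp t) = cis (\sum_v t v *~ mu v).
Proof. by rewrite cis_sum /chi; apply: eq_bigr => v _; rewrite texpE cisMz. Qed.

Lemma chi_texp_line mu (t : {ffun I -> R^o}) s :
  chi mu (texp (s *: t)) = cis (s * \sum_v t v *~ mu v).
Proof.
rewrite chi_texp mulr_sumr; congr cis; apply: eq_bigr => v _.
by rewrite ffunE mulrzAr.
Qed.

Lemma chi_texp_line_trivial mu (t : {ffun I -> R^o}) :
  (forall s, chi mu (texp (s *: t)) = 1) -> \sum_v t v *~ mu v = 0.
Proof. by move=> h; apply: cis_line_eq0 => s; rewrite -chi_texp_line. Qed.

Lemma connected_texp_line (t : {ffun I -> R^o}) :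
  connected [set texp (s *: t) | s in [set: R]].
Proof.
apply: connected_continuous_connected.
  by apply/connected_intervalP => x y _ _.
apply: continuous_subspaceT => s U /nbhs_boxP[e e0 eU].
have h : \forall s' \near s, forall v, `|texp (s *: t) v - texp (s' *: t) v| < e.
  apply: (@filter_forall R I (fun v => [set s' | `|texp (s *: t) v - texp (s' *: t) v| < e]) (nbhs s)) => v.
  have c : {for s, continuous (fun s' : R => cis (s' * t v))}.
    apply: (@continuous_comp _ _ _ (fun s' : R => s' * t v) cis).
      exact: mulrr_continuous.
    exact: continuous_cis.
  have /= := c [set z | `|cis (s * t v) - z| < e].
  move=> /(_ _)[]; first by apply/nbhs_complexP; exists e.
  move=> d d0 dh; exists d => // s' hs'.
  rewrite /= !texpE !ffunE; exact: (dh s').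
apply: (@filterS _ _ (nbhs_filter s) _ _ _ h) => s' hs'; exact: eU.
Qed.
End Exponential.

(** * Integer vectors over the rationals and over the reals *)

Lemma common_denominator (J : finType) (q : J -> rat) :
  exists2 D : nat, (0 < D)%N & exists m : J -> int, forall j, D%:R * q j = (m j)%:~R.
Proof.
exists (\prod_j `|denq (q j)|)%N.
  by rewrite prodn_gt0 // => j; rewrite absz_gt0 denq_neq0.
exists (fun j => (\prod_(i | i != j) `|denq (q i)|%N)%N%:Z * numq (q j)) => j.
rewrite (bigD1 j) //= natrM mulrAC mulrC intrM; congr (_ * _).
by rewrite -{2}(divq_num_den (q j)) mulrC -[X in _ * X]/(`|denq (q j)|%N%:Z%:~R) gez0_abs ?denq_ge0 // divfK // intr_eq0 denq_neq0.
Qed.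

Section MaxFree.
Variables (K : fieldType) (vT : vectType K).

Lemma maximal_free_seq (X : set vT) : exists s : seq vT,
  [/\ (forall x, x \in s -> X x), free s & (forall x, X x -> x \in <<s>>%VS)].
Proof.
pose P n := `[< exists s : seq vT, [/\ (forall x, x \in s -> X x), free s & size s = n] >].
have exP : exists n, P n.
  exists 0%N; apply/asboolP; exists [::]; split => //; exact: nil_free.
have ubP n : P n -> (n <= \dim {:vT})%N.
  by move=> /asboolP[s [_ /eqP <- <-]]; rewrite dimvS // subvf.
case: (ex_maxnP exP ubP) => n /asboolP[s [sX fs sn]] nmax.
exists s; split => // x Xx; apply: contraT => xs.
have : P n.+1.
  apply/asboolP; exists (x :: s); split => //=; last by rewrite sn.
    by move=> y; rewrite inE => /orP[/eqP -> //|/sX].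
  by rewrite free_cons xs.
by move/nmax; rewrite ltnn.
Qed.
End MaxFree.

Section IntegerVectors.
Variable I : finType.

Definition int_vec (F : fieldType) (f : {ffun I -> int}) : {ffun I -> F^o} :=
  [ffun v => (f v)%:~R].

Lemma int_vec_pairing (F : fieldType) (mu : I -> int) (f : {ffun I -> int}) :
  \sum_v int_vec F f v *~ mu v = (\sum_v mu v * f v)%:~R.
Proof.
transitivity (\sum_v (mu v * f v)%:~R : F); last by rewrite rmorph_sum.
by apply: eq_bigr => v _; rewrite ffunE intrM mulrC mulrzr.
Qed.

Definition int_mx (F : fieldType) n (s : n.-tuple {ffun I -> int}) : 'M[F]_(n, #|I|) :=
  \matrix_(i, j) (tnth s i (enum_val j))%:~R.

Lemma int_mx_comb (F : fieldType) n (s : n.-tuple {ffun I -> int}) (k : 'rV[F]_n) :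
  k *m int_mx F s = \row_j (\sum_(i < n) k 0 i *: int_vec F (tnth s i)) (enum_val j).
Proof.
apply/rowP => j; rewrite !mxE sum_ffunE; apply: eq_bigr => i _.
by rewrite mxE !ffunE.
Qed.

Lemma int_mx_eq0 (F : fieldType) n (s : n.-tuple {ffun I -> int}) (k : 'rV[F]_n) :
  (k *m int_mx F s == 0) = (\sum_(i < n) k 0 i *: int_vec F (tnth s i) == 0).
Proof.
rewrite int_mx_comb; apply/eqP/eqP => [/rowP h|->]; last by apply/rowP => j; rewrite !mxE ffunE.
by apply/ffunP => v; have := h (enum_rank v); rewrite !mxE enum_rankK => ->; rewrite ffunE.
Qed.

Lemma free_int_vec (F : fieldType) n (s : n.-tuple {ffun I -> int}) :
  free (map (int_vec F) s) = row_free (int_mx F s).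
Proof.
have nthE (i : 'I_n) : (map (int_vec F) s)`_i = int_vec F (tnth s i).
  by rewrite (nth_map (tnth s i)) ?size_tuple // -tnth_nth.
apply/idP/idP => [/(freeP (X := [tuple of map (int_vec F) s])) fs|].
  rewrite -kermx_eq0; apply/eqP/row_matrixP => i; rewrite row0.
  have : row i (kermx (int_mx F s)) *m int_mx F s == 0.
    by rewrite -row_mul mulmx_ker row0.
  rewrite int_mx_eq0 => /eqP h; apply/rowP => j; rewrite [RHS]mxE.
  by apply: (fs (fun j => row i (kermx (int_mx F s)) 0 j)); rewrite -[RHS]h; apply: eq_bigr => l _; rewrite nthE.
move=> rf; apply/(freeP (X := [tuple of map (int_vec F) s])) => k h i.
have : (\row_j k j) *m int_mx F s == 0.
  rewrite int_mx_eq0; apply/eqP; rewrite -[RHS]h; apply: eq_bigr => l _.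
  by rewrite mxE nthE.
by move/eqP/(congr1 (mulmxr (pinvmx (int_mx F s)))); rewrite /= mulmxKp // mul0mx => /rowP/(_ i); rewrite !mxE.
Qed.

Lemma mem_span_int_vec (F : fieldType) n (s : n.-tuple {ffun I -> int}) (t : {ffun I -> F^o}) :
  (\row_j t (enum_val j) <= int_mx F s)%MS -> t \in <<map (int_vec F) s>>%VS.
Proof.
move=> /submxP[k]; rewrite int_mx_comb => /rowP h.
have -> : t = \sum_(i < n) k 0 i *: int_vec F (tnth s i).
  by apply/ffunP => v; have := h (enum_rank v); rewrite !mxE enum_rankK.
by apply: memv_suml => i _; rewrite memvZ // memv_span // map_f // mem_tnth.
Qed.

Lemma int_mx_ratr (R : numFieldType) n (s : n.-tuple {ffun I -> int}) :
  int_mx R s = map_mx (ratr : rat -> R) (int_mx rat s).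
Proof. by apply/matrixP => i j; rewrite !mxE ratr_int. Qed.

(** Freeness is a condition on the rank of a matrix, which a field extension does not change. *)
Lemma free_int_vec_extend (R : numFieldType) n (s : n.-tuple {ffun I -> int}) :
  free (map (int_vec rat) s) -> free (map (int_vec R) s).
Proof. by rewrite !free_int_vec int_mx_ratr /row_free mxrank_map. Qed.

(* Because the orthogonal complement of a rational subspace is spanned by integer vectors. *)
Lemma integer_orthogonal_span (R : numFieldType) n (s : n.-tuple {ffun I -> int})
    (t : {ffun I -> R^o}) :
  (forall mu : I -> int, (forall f, f \in s -> \sum_v mu v * f v = 0) ->
     \sum_v t v *~ mu v = 0) ->
  t \in <<map (int_vec R) s>>%VS.
Proof.
move=> h; apply: mem_span_int_vec; rewrite int_mx_ratr submxE -map_cokermx.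
apply/eqP/rowP => j; rewrite [RHS]mxE.
(* A column of the rational cokernel, cleared of denominators, is an integer vector orthogonal to
   [s], hence to [t]. Vanishing against all columns is membership in the row space. *)
have [D D0 [m mE]] := common_denominator (fun v => cokermx (int_mx rat s) (enum_rank v) j).
have DR : D%:R != 0 :> R by rewrite pnatr_eq0 -lt0n.
have mR v : (m v)%:~R = D%:R * ratr (cokermx (int_mx rat s) (enum_rank v) j) :> R.
  by rewrite -(ratr_int R) -mE rmorphM /= ratr_nat.
have sm f : f \in s -> \sum_v m v * f v = 0.
  move=> /tnthP[i ->]; apply/eqP; rewrite -(intr_eq0 rat) rmorph_sum /=.
  have /matrixP/(_ i j) := mulmx_coker (int_mx rat s); rewrite !mxE => e0.
  rewrite (eq_bigr (fun v => D%:R * (int_mx rat s i (enum_rank v) * cokermx (int_mx rat s) (enum_rank v) j))).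
    rewrite -mulr_sumr (reindex (enum_val : 'I_#|I| -> I)) /=; last first.
      by exists enum_rank => v _; rewrite ?enum_valK ?enum_rankK.
    by under eq_bigr => v _ do rewrite enum_valK; rewrite e0 mulr0.
  by move=> v _; rewrite intrM -mE [int_mx _ _ _ _]mxE enum_rankK mulrAC mulrA.
have /eqP := h m sm.
rewrite (eq_bigr (fun v => D%:R * (t v * ratr (cokermx (int_mx rat s) (enum_rank v) j)))).
  rewrite -mulr_sumr mulf_eq0 (negPf DR) /= => /eqP e.
  rewrite mxE -[RHS]e (reindex (enum_rank : I -> 'I_#|I|)) /=; last first.
    by exists enum_val => v _; rewrite ?enum_valK ?enum_rankK.
  by apply: eq_bigr => v _; rewrite !mxE enum_rankK.
by move=> v _; rewrite -mulrzr mR mulrCA.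
Qed.
End IntegerVectors.

(** * Integral elements *)

Section Integers.
Variable L : splittingFieldType rat.
Notation G := (gal_of {:L}).

Record subring_pred (P : L -> Prop) : Prop := SubringPred {
  subring_pred1 : P 1;
  subring_predB : forall x y, P x -> P y -> P (x - y);
  subring_predM : forall x y, P x -> P y -> P (x * y) }.

Section SubringPred.
Variable P : L -> Prop.
Hypothesis sP : subring_pred P.

Lemma subring_pred0 : P 0.
Proof. by rewrite -(subrr 1); apply: subring_predB => //; exact: subring_pred1. Qed.

Lemma subring_predN x : P x -> P (- x).
Proof. by move=> Px; rewrite -sub0r; apply: subring_predB => //; exact: subring_pred0. Qed.

Lemma subring_predD x y : P x -> P y -> P (x + y).
Proof. by move=> Px Py; rewrite -(opprK y); apply: subring_predB => //; exact: subring_predN. Qed.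

Lemma subring_pred_sum (J : Type) (r : seq J) (p : pred J) (f : J -> L) :
  (forall j, p j -> P (f j)) -> P (\sum_(j <- r | p j) f j).
Proof. by move=> h; elim/big_ind: _ => //; [exact: subring_pred0|exact: subring_predD]. Qed.

Lemma subring_pred_prod (J : Type) (r : seq J) (p : pred J) (f : J -> L) :
  (forall j, p j -> P (f j)) -> P (\prod_(j <- r | p j) f j).
Proof. by move=> h; elim/big_ind: _ => //; [exact: subring_pred1 sP|exact: subring_predM]. Qed.

Lemma subring_predX x n : P x -> P (x ^+ n).
Proof.
move=> Px; elim: n => [|n IH]; first exact: subring_pred1.
by rewrite exprS; exact: subring_predM.
Qed.

Lemma subring_pred_nat n : P n%:R.
Proof.
elim: n => [|n IH]; first exact: subring_pred0.
by rewrite -natr1; apply: subring_predD => //; exact: subring_pred1.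
Qed.

Lemma subring_pred_int (n : int) : P n%:~R.
Proof.
by case: n => n; rewrite ?NegzE ?mulrNz -?pmulrn; [|apply: subring_predN]; exact: subring_pred_nat.
Qed.

Lemma subring_pred_coef_prod (J : Type) (r : seq J) (f : J -> L) :
  (forall j, P (f j)) -> forall i, P (\prod_(j <- r) ('X - (f j)%:P))`_i.
Proof.
move=> h; elim: r => [|j r IH] i.
  by rewrite big_nil coef1; case: (i == 0)%N; [exact: subring_pred1|exact: subring_pred0].
rewrite big_cons mulrBl coefB coefXM coefCM.
apply: subring_predB => //; last exact: subring_predM.
by case: (i == 0)%N => //; exact: subring_pred0.
Qed.
End SubringPred.

Lemma integralE (x : L) : integral x <-> integralOver (intmul 1 : int -> L) x.
Proof. by split=> [[q [qm qx]]|[q qm qx]]; exists q. Qed.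

Lemma integral_subring : subring_pred (@integral L).
Proof.
split; first by apply/integralE/integral1.
  by move=> x y /integralE ix /integralE iy; apply/integralE/integral_sub.
by move=> x y /integralE ix /integralE iy; apply/integralE/integral_mul.
Qed.

Definition integralB := subring_predB integral_subring.
Definition integralD := subring_predD integral_subring.
Definition integralM := subring_predM integral_subring.
Definition integralN := subring_predN integral_subring.
Definition integralX := subring_predX integral_subring.
Definition integral_natr := subring_pred_nat integral_subring.
Definition integral_intr := subring_pred_int integral_subring.

Lemma integral_gal (g : G) (x : L) : integral x -> integral (g x).
Proof.
move=> [q [qm qx]]; exists q; split => //.
rewrite /root -[X in _.[X]]/(gal_repr g x).
have -> : map_poly (fun z : int => z%:~R) q = map_poly (gal_repr g) (map_poly (fun z : int => z%:~R : L) q).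
  by rewrite -map_poly_comp; apply: eq_map_poly => z /=; rewrite rmorph_int.
by rewrite horner_map /= (rootP qx) rmorph0.
Qed.

Lemma integral_rat (q : rat) : integral (q%:A : L) -> exists n : int, q = n%:~R.
Proof.
move=> [r [rm rq]].
have rootq : root (map_poly (intr : int -> rat) r) q.
  move: rq; have -> : map_poly (fun z : int => z%:~R) r =
      map_poly (in_alg L) (map_poly (intr : int -> rat) r).
    by rewrite -map_poly_comp; apply: eq_map_poly => z /=; rewrite -[RHS]/(in_alg L z%:~R) rmorph_int.
  by rewrite -[q%:A]/(in_alg L q) fmorph_root.
have Aq : (ratr q : algC) \in Aint.
  apply: (@root_monic_Aint (map_poly (intr : int -> algC) r)).
  - have -> : map_poly (intr : int -> algC) r = map_poly (ratr : rat -> algC) (map_poly (intr : int -> rat) r).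
      by rewrite -map_poly_comp; apply: eq_map_poly => z /=; rewrite ratr_int.
    by rewrite fmorph_root.
  - exact: monic_map.
  - by apply/polyOverP => i; rewrite coef_map /= intr_int.
have := Cint_rat_Aint (Crat_rat q) Aq.
move=> /intrP[n hn]; exists n; apply: (fmorph_inj (ratr : rat -> algC)).
exact: etrans hn (esym (ratr_int _ _)).
Qed.

Hypothesis galL : galois 1%VS {:L}.

Lemma gal_fixed_rat (x : L) : (forall g : G, g x = x) -> exists q : rat, x = q%:A.
Proof.
move=> h; have /eqP fixE : fixedField 'Gal({:L} / 1%AS)%g == 1%VS :> {vspace L}.
  by apply/eqP/galois_fixedField.
have : x \in fixedField 'Gal({:L} / 1%AS)%g by apply/fixedFieldP; rewrite ?memvf.
by rewrite fixE => /vlineP[q ->]; exists q.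
Qed.

Lemma galMf (g h : G) x : (g * h)%g x = h (g x).
Proof. by rewrite galM ?memvf. Qed.

Lemma gal1f x : (1%g : G) x = x.
Proof. exact: gal_id. Qed.

Lemma galKf (g : G) : cancel g (g^-1)%g.
Proof. by move=> x; rewrite -galMf mulgV gal1f. Qed.

Lemma galKVf (g : G) : cancel (g^-1)%g g.
Proof. by move=> x; rewrite -galMf mulVg gal1f. Qed.

(** The characteristic polynomial of [x] over the rationals. Its degree is the same for all [x],
    which permits uniform bounds on its coefficients. *)
Definition conj_poly (x : L) : {poly L} := \prod_(g : G) ('X - (g x)%:P).

Lemma conj_poly_monic x : conj_poly x \is monic.
Proof. by apply: monic_prod => g _; exact: monicXsubC. Qed.

Lemma root_conj_poly x y : root (conj_poly x) y -> exists g : G, y = g x.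
Proof.
rewrite /root /conj_poly horner_prod => /prodf_eq0[g _]; rewrite hornerXsubC subr_eq0 => /eqP ->.
by exists g.
Qed.

Lemma root_conj_poly_self x : root (conj_poly x) x.
Proof.
rewrite /root /conj_poly horner_prod; apply/prodf_eq0; exists 1%g => //.
by rewrite hornerXsubC gal1f subrr.
Qed.

Lemma conj_poly_rat x : exists2 p : {poly rat}, p \is monic & conj_poly x = map_poly (in_alg L) p.
Proof.
have fix_coef i : exists q : rat, (conj_poly x)`_i = q%:A.
  apply: gal_fixed_rat => h.
  have e : map_poly (gal_repr h) (conj_poly x) = conj_poly x.
    rewrite /conj_poly rmorph_prod /= [RHS](reindex_inj (mulIg h)) /=.
    by apply: eq_bigr => g _; rewrite rmorphB /= map_polyX map_polyC /= galMf.
  by rewrite -[in RHS]e coef_map.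
have [q hq] := choice fix_coef.
pose p := \poly_(i < size (conj_poly x)) q i.
have pE : conj_poly x = map_poly (in_alg L) p.
  apply/polyP => i; rewrite coef_map coef_poly /=; case: ltnP => // h.
  by rewrite nth_default // scale0r.
exists p => //.
by have := conj_poly_monic x; rewrite pE map_monic.
Qed.

(* Applied both to the integers and to the a priori larger ring of almost
   integral elements: this shows that the two rings coincide. *)
Lemma integral_of_subring (P : L -> Prop) : subring_pred P ->
  (forall (g : G) x, P x -> P (g x)) ->
  (forall q : rat, P q%:A -> exists n : int, q = n%:~R) ->
  forall x, P x -> exists2 q : {poly int}, q \is monic & conj_poly x = map_poly (intr : int -> L) q.
Proof.
move=> sP galP ratP x Px.
have [p pm pE] := conj_poly_rat x.
have coefP i : exists n : int, p`_i = n%:~R.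
  apply: ratP; rewrite -[_%:A]/(in_alg L _) -coef_map -pE.
  by apply: subring_pred_coef_prod => // g; exact: galP.
have [n hn] := choice coefP.
pose q := \poly_(i < size p) n i.
have qE : p = map_poly intr q.
  apply/polyP => i; rewrite coef_map coef_poly /=; case: ltnP => h.
    by rewrite hn.
  by rewrite nth_default.
exists q.
  rewrite monicE; apply/eqP/(@intr_inj rat).
  by rewrite -(lead_coef_map_inj (@intr_inj rat)) // -qE (monicP pm).
by rewrite pE qE -map_poly_comp; apply: eq_map_poly => z /=; rewrite -[LHS]/(in_alg L z%:~R) rmorph_int.
Qed.

Lemma integral_conj_poly x : integral x ->
  exists2 q : {poly int}, q \is monic & conj_poly x = map_poly (intr : int -> L) q.
Proof.
exact: integral_of_subring integral_subring integral_gal integral_rat x.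
Qed.

(** All powers of [x] share the denominator [D]. This is the form in which integrality is obtained
    when multiplication by [x] preserves an ideal. *)
Definition almost_integral (x : L) :=
  exists2 D : nat, (0 < D)%N & forall k, integral (D%:R * x ^+ k).

Lemma almost_integral_subring : subring_pred almost_integral.
Proof.
split.
- by exists 1%N => // k; rewrite expr1n mulr1; exact: integral_natr.
- move=> x y [D D0 Dx] [E E0 Ey]; exists (D * E)%N; first by rewrite muln_gt0 D0.
  move=> k; rewrite exprBn mulr_sumr; apply: (subring_pred_sum integral_subring) => i _.
  have -> : (D * E)%:R * ((-1) ^+ i * x ^+ (k - i) * y ^+ i *+ 'C(k, i)) =
     (-1) ^+ i * 'C(k, i)%:R * (D%:R * x ^+ (k - i)) * (E%:R * y ^+ i) :> L.
    by rewrite natrM -mulr_natr; ring.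
  do !apply: integralM => //; last exact: integral_natr.
  by apply: integralX; apply: integralN; exact: integral_natr 1%N.
- move=> x y [D D0 Dx] [E E0 Ey]; exists (D * E)%N; first by rewrite muln_gt0 D0.
  move=> k; rewrite natrM exprMn mulrACA; exact: integralM.
Qed.

(** Every power of the denominator of [q] divides [D], which forces this denominator to be 1. *)
Lemma almost_integral_rat (q : rat) : almost_integral q%:A -> exists n : int, q = n%:~R.
Proof.
move=> [D D0 Dq].
have dvd k : (`|denq q| ^ k %| D)%N.
  have : integral ((D%:R * q ^+ k)%:A : L).
    rewrite -[_%:A]/(in_alg L _) rmorphM rmorphXn rmorph_nat; exact: Dq.
  move=> /integral_rat[n hn].
  have : D%:Z * numq q ^+ k = n * denq q ^+ k.
    apply: (@intr_inj rat); rewrite !rmorphM !rmorphXn /= -hn -mulrA -exprMn.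
    by rewrite -numqE.
  move=> /(congr1 absz); rewrite !abszM !abszX absz_nat => e.
  have : (`|denq q| ^ k %| D * `|numq q| ^ k)%N by rewrite e dvdn_mull.
  rewrite Gauss_dvdl // coprimeXl // coprimeXr // coprime_sym; exact: coprime_num_den.
have d1 : `|denq q|%N = 1%N.
  apply/eqP; rewrite eqn_leq absz_gt0 denq_neq0 andbT leqNgt; apply/negP => d1.
  have := dvdn_leq D0 (dvd D); rewrite leqNgt => /negP; apply; exact: ltn_expl.
exists (numq q); rewrite -{1}(divq_num_den q).
by rewrite -[denq q]gez0_abs ?denq_ge0 // d1 divr1.
Qed.

Lemma almost_integral_integral x : almost_integral x -> integral x.
Proof.
move=> ax.
have [|q qm qE] := integral_of_subring almost_integral_subring _ almost_integral_rat ax.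
  move=> g y [D D0 Dy]; exists D => // k.
  have -> : D%:R * g y ^+ k = g (D%:R * y ^+ k) by rewrite rmorphM rmorphXn rmorph_nat.
  exact: integral_gal.
exists q; split => //; have := root_conj_poly_self x; by rewrite qE.
Qed.

Lemma integral_multiple (x : L) : exists2 D : nat, (0 < D)%N & integral (D%:R * x : L).
Proof.
have [p pm pE] := conj_poly_rat x.
have px : (map_poly (in_alg L) p).[x] = 0 by apply/eqP; rewrite -/(root _ _) -pE; exact: root_conj_poly_self.
pose n := (size p).-1.
have sn : size p = n.+1 by rewrite /n prednK // size_poly_gt0 monic_neq0.
have pn : p`_n = 1 by move/monicP: pm; rewrite lead_coefE.
have [D D0 [m mE]] := common_denominator (fun i : 'I_n.+1 => p`_i).
exists D => //.
(* The coefficients of [D ^ n p(X / D)]: below the leading one, one factor of [D ^ (n - i)] is spent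
   on clearing the denominator. *)
pose c i : int := if (i == n)%N then 1 else D%:Z ^+ (n - i.+1) * m (inord i).
pose r : {poly int} := \poly_(i < n.+1) c i.
exists r; split.
  by rewrite monicE lead_coef_poly // /c eqxx.
have -> : map_poly (fun z : int => z%:~R) r = \poly_(i < n.+1) (c i)%:~R :> {poly L}.
  apply/polyP => i; rewrite coef_map_id0 //= !coef_poly.
  by case: ltnP.
rewrite /root horner_poly; apply/eqP.
transitivity (D%:R ^+ n * (map_poly (in_alg L) p).[x]); last by rewrite px mulr0.
rewrite horner_coef size_map_poly sn mulr_sumr; apply: eq_bigr => i _.
rewrite coef_map /= exprMn /c; case: eqP => [->|/eqP in_].
  by rewrite pn scale1r !mul1r.
have iltn : (i < n)%N by rewrite ltn_neqAle in_ -ltnS ltn_ord.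
rewrite intrM rmorphXn /= inord_val.
have -> : (m i)%:~R = D%:R * (p`_i)%:A :> L.
  by rewrite -(rmorph_nat (in_alg L)) -[(p`_i)%:A]/(in_alg L p`_i) -rmorphM mE rmorph_int.
have -> : D%:R ^+ n = D%:R ^+ (n - i.+1) * (D%:R * D%:R ^+ i) :> L.
  by rewrite -exprS -exprD subnK.
rewrite pmulrn.
by move: ((p`_i)%:A) (x ^+ i) (D%:~R ^+ _) (D%:~R ^+ _) => a b d e; ring.
Qed.
End Integers.

(** * Traces, norms and residues *)

Section Primes.
Variable L : splittingFieldType rat.
Notation G := (gal_of {:L}).
Hypothesis galL : galois 1%VS {:L}.

Lemma algM (a b : rat) : (a * b)%:A = a%:A * b%:A :> L.
Proof. exact: (rmorphM (in_alg L)). Qed.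

Lemma alg_nat n : n%:R%:A = n%:R :> L.
Proof. exact: (rmorph_nat (in_alg L)). Qed.

Lemma alg_int (n : int) : n%:~R%:A = n%:~R :> L.
Proof. exact: (rmorph_int (in_alg L)). Qed.

Lemma alg_sum (J : finType) (f : J -> rat) : (\sum_j f j)%:A = \sum_j (f j)%:A :> L.
Proof. exact: (rmorph_sum (in_alg L)). Qed.

Lemma alg_inj : injective (fun a : rat => a%:A : L).
Proof. exact: (fmorph_inj (in_alg L)). Qed.

Lemma natr_neq0 (n : nat) : (0 < n)%N -> n%:R != 0 :> L.
Proof. by rewrite -alg_nat -[_%:A]/(in_alg L _) fmorph_eq0 pnatr_eq0 -lt0n. Qed.

Definition trace (x : L) : L := \sum_(g : G) g x.

Lemma traceD x y : trace (x + y) = trace x + trace y.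
Proof. by rewrite /trace -big_split; apply: eq_bigr => g _; rewrite rmorphD. Qed.

Lemma traceB x y : trace (x - y) = trace x - trace y.
Proof. by rewrite /trace -sumrB; apply: eq_bigr => g _; rewrite rmorphB. Qed.

Lemma traceZ (q : rat) x : trace (q%:A * x) = q%:A * trace x.
Proof.
rewrite /trace mulr_sumr; apply: eq_bigr => g _.
by rewrite rmorphM /= linearZ /= rmorph1.
Qed.

Lemma trace_sum (J : Type) (r : seq J) (f : J -> L) :
  trace (\sum_(j <- r) f j) = \sum_(j <- r) trace (f j).
Proof.
apply: (big_morph trace traceD); rewrite /trace big1 // => g _; exact: rmorph0.
Qed.

Lemma trace_rat x : exists q : rat, trace x = q%:A.
Proof.
apply: gal_fixed_rat => // h; rewrite /trace rmorph_sum [RHS](reindex_inj (mulIg h)) /=.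
by apply: eq_bigr => g _; rewrite galMf.
Qed.

Lemma trace_integral x : integral x -> exists n : int, trace x = n%:~R.
Proof.
move=> ix; have [q qE] := trace_rat x.
have [|n nE] := @integral_rat L q.
  by rewrite -qE; apply: (subring_pred_sum (integral_subring L)) => g _; exact: integral_gal.
by exists n; rewrite qE nE -[_%:A]/(in_alg L _) rmorph_int.
Qed.

Definition norm (x : L) : L := \prod_(g : G) g x.

Lemma normM x y : norm (x * y) = norm x * norm y.
Proof. by rewrite /norm -big_split; apply: eq_bigr => g _; rewrite rmorphM. Qed.

Lemma norm_eq0 x : (norm x == 0) = (x == 0).
Proof.
apply/idP/idP => [/prodf_eq0[g _]|/eqP ->]; first by rewrite fmorph_eq0.
by apply/prodf_eq0; exists (1%g : G) => //; rewrite rmorph0.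
Qed.

Lemma norm_rat x : exists q : rat, norm x = q%:A.
Proof.
apply: gal_fixed_rat => // h; rewrite /norm rmorph_prod [RHS](reindex_inj (mulIg h)) /=.
by apply: eq_bigr => g _; rewrite galMf.
Qed.

Lemma norm_integral x : integral x -> exists n : int, norm x = n%:~R.
Proof.
move=> ix; have [q qE] := norm_rat x.
have [|n nE] := @integral_rat L q.
  by rewrite -qE; apply: (subring_pred_prod (integral_subring L)) => g _; exact: integral_gal.
by exists n; rewrite qE nE -[_%:A]/(in_alg L _) rmorph_int.
Qed.

Lemma norm_multiple x : integral x -> exists2 y, integral y & norm x = y * x.
Proof.
move=> ix; exists (\prod_(g : G | g != 1%g) g x).
  by apply: (subring_pred_prod (integral_subring L)) => g _; exact: integral_gal.
by rewrite /norm (bigD1 (1%g : G)) //= gal1f mulrC.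
Qed.

Lemma integral_generators : exists (n : nat) (b : 'I_n -> L),
  (forall i, integral (b i)) /\
  forall x, exists q : 'I_n -> rat, x = \sum_i (q i)%:A * b i.
Proof.
pose v := vbasis {:L}.
have mult i : exists D : nat, (0 < D)%N /\ integral (D%:R * tnth v i).
  by have [D D0 iD] := integral_multiple galL (tnth v i); exists D.
have [D hD] := choice mult.
exists (\dim {:L}), (fun i => (D i)%:R * tnth v i); split; first by move=> i; case: (hD i).
move=> x; exists (fun i => coord v i x / (D i)%:R).
have /coord_span {1}-> : x \in <<v>>%VS by rewrite (span_basis (vbasisP _)) memvf.
apply: eq_bigr => i _.
have D0 : (D i)%:R != 0 :> rat by rewrite pnatr_eq0 -lt0n; case: (hD i).
rewrite mulrA -(rmorph_nat (in_alg L)) -[(_ / _)%:A]/(in_alg L _) -rmorphM divfK //=.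
by rewrite mulr_algl (tnth_nth 0).
Qed.

(** The trace of [x * x^-1] is the order of the Galois group, whereas expanding [x^-1] along [b]
    would make it 0. *)
Lemma trace_form_nondegenerate n (b : 'I_n -> L) (x : L) :
  (forall y, exists q : 'I_n -> rat, y = \sum_i (q i)%:A * b i) ->
  (forall j, trace (x * b j) = 0) -> x = 0.
Proof.
move=> gen h; apply/eqP; apply: contraT => x0.
have [q qE] := gen x^-1.
have : trace (x * x^-1) = 0.
  rewrite {1}qE mulr_sumr trace_sum big1 // => i _.
  by rewrite mulrCA traceZ h mulr0.
rewrite divff // /trace (eq_bigr (fun=> 1)); last by move=> g _; rewrite rmorph1.
rewrite sumr_const => /eqP.
rewrite -(rmorph_nat (in_alg L)) fmorph_eq0 pnatr_eq0.
by rewrite (cardD1 (1%g : G)).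
Qed.

(** The label of an integer consists of its traces against integral generators [b], modulo [d * m],
    where [d] clears the denominators of the pseudo-inverse of the trace matrix. When labels agree,
    solving the linear system writes [x - y] as [m] times an integral combination of the [b i]. *)
Lemma finite_residues (m : nat) : (0 < m)%N -> exists (F : finType) (phi : L -> F),
  forall x y, integral x -> integral y -> phi x = phi y ->
  exists2 z, integral z & x - y = m%:R * z.
Proof.
move=> m0; have [n [b [bi gen]]] := integral_generators.
have [T hT] := choice (fun ij : 'I_n * 'I_n => trace_rat (b ij.1 * b ij.2)).
pose M : 'M[rat]_n := \matrix_(i, j) T (i, j).
have [d d0 [e eE]] := common_denominator (fun ij : 'I_n * 'I_n => pinvmx M ij.1 ij.2).
have tint (xj : L * 'I_n) : exists t : int, integral xj.1 -> trace (xj.1 * b xj.2) = t%:~R.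
  have [ix|nix] := pselect (integral xj.1); last by exists 0.
  by have [t tE] := trace_integral (integralM ix (bi xj.2)); exists t.
have [t tE] := choice tint.
have dm0 : (0 < d * m)%N by rewrite muln_gt0 d0.
exists {ffun 'I_n -> 'I_(d * m).-1.+1}.
exists (fun x => [ffun j => inord `|(t (x, j) %% (d * m)%:Z)%Z|%N]).
move=> x y ix iy /ffunP h.
have hdiff j : exists k : int, trace ((x - y) * b j) = (d * m)%:R * k%:~R.
  have /(congr1 val) := h j; rewrite !ffunE /= !inordK ?prednK //; last 2 first.
  - by rewrite -ltz_nat gez0_abs ?modz_ge0 ?ltz_pmod // -lt0n.
  - by rewrite -ltz_nat gez0_abs ?modz_ge0 ?ltz_pmod // -lt0n.
  move=> /(congr1 Posz); rewrite !gez0_abs ?modz_ge0 -?lt0n // => /eqP.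
  rewrite eqz_mod_dvd => /dvdzP[k kE]; exists k.
  rewrite mulrBl traceB (tE (x, j)) // (tE (y, j)) // -rmorphB /= kE.
  by rewrite intrM mulrC pmulrn.
have [k kE] := choice hdiff.
pose c i : int := \sum_j k j * e (j, i).
have xyE : x - y = m%:R * \sum_i (c i)%:~R * b i.
  have [q qE] := gen (x - y).
  pose tau : 'rV[rat]_n := \row_j ((d * m)%:R * (k j)%:~R).
  have tauM : (\row_i q i) *m M = tau.
    apply/rowP => j; rewrite !mxE; apply: alg_inj.
    rewrite algM alg_nat alg_int -kE qE mulr_suml trace_sum alg_sum.
    by apply: eq_bigr => i _; rewrite !mxE -mulrA traceZ (hT (i, j)) algM.
  have tau_c : tau *m pinvmx M = \row_i (m%:R * (c i)%:~R).
    apply/rowP => i; rewrite !mxE /c rmorph_sum mulr_sumr /=; apply: eq_bigr => j _.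
    by rewrite [tau _ _]mxE intrM -(eE (j, i)) /= natrM; ring.
  (* [tau] is in the row space of [M], so the pseudo-inverse yields an exact solution. *)
  have tau_c2 : (\row_i (m%:R * (c i)%:~R)) *m M = tau.
    by rewrite -tau_c mulmxKpV // -tauM submxMl.
  apply/eqP; rewrite -subr_eq0; apply/eqP.
  apply: (trace_form_nondegenerate gen) => j.
  rewrite mulrBl traceB.
  rewrite kE mulr_sumr mulr_suml trace_sum.
  apply/eqP; rewrite subr_eq0 -alg_nat -alg_int -algM; apply/eqP.
  have := congr1 (fun A : 'rV_n => A 0 j) tau_c2; rewrite !mxE => <-.
  rewrite alg_sum; apply: eq_bigr => i _; rewrite !mxE.
  have -> : m%:R * ((c i)%:~R * b i) * b j = (m%:R * (c i)%:~R)%:A * (b i * b j) :> L.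
    by rewrite algM alg_nat alg_int !mulrA.
  by rewrite traceZ (hT (i, j)) -algM.
exists (\sum_i (c i)%:~R * b i) => //.
apply: (subring_pred_sum (integral_subring L)) => i _.
by apply: integralM => //; exact: integral_intr.
Qed.
End Primes.

(** * Ideals and primes *)

Section Ideals.
Variable L : splittingFieldType rat.
Notation G := (gal_of {:L}).
Hypothesis galL : galois 1%VS {:L}.

Definition ideal (A : set L) : Prop :=
  [/\ (forall x, A x -> integral x), A 0, (forall x y, A x -> A y -> A (x + y)) &
      (forall a x, integral a -> A x -> A (a * x))].

Lemma idealB A x y : ideal A -> A x -> A y -> A (x - y).
Proof.
move=> [_ _ AD AM] Ax Ay; apply: AD => //; rewrite -mulN1r; apply: AM => //.
exact: integralN (subring_pred1 (integral_subring L)).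
Qed.

Lemma nat_multiple (x : L) : integral x -> x != 0 ->
  exists2 m : nat, (0 < m)%N & exists2 y, integral y & m%:R = y * x.
Proof.
move=> ix x0; have [n nE] := norm_integral galL ix.
have [y iy yE] := norm_multiple ix.
have n0 : n != 0.
  by apply: contra_neq x0 => n0; apply/eqP; rewrite -norm_eq0 nE n0.
exists `|n|%N; first by rewrite absz_gt0.
have [nge0|nlt0] := lerP 0 n.
  by exists y => //; rewrite pmulrn gez0_abs // -nE.
by exists (- y); [exact: integralN | rewrite pmulrn ltz0_abs // mulrNz -nE yE mulNr].
Qed.

Lemma ideal_nat A x : ideal A -> A x -> x != 0 -> exists2 m : nat, (0 < m)%N & A m%:R.
Proof.
move=> [Ai _ _ AM] Ax x0; have [m m0 [y iy e]] := nat_multiple (Ai _ Ax) x0.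
by exists m => //; rewrite e; exact: AM.
Qed.

(* Ideals containing [m] are determined by their image in a finite set of
   residues, so there are finitely many of them. *)
Lemma maximal_ideal (Pr : set L -> Prop) (m : nat) (A0 : set L) : (0 < m)%N ->
  ideal A0 -> A0 m%:R -> Pr A0 ->
  exists A, [/\ ideal A, A m%:R, Pr A &
    forall B, ideal B -> Pr B -> A `<=` B -> B `<=` A].
Proof.
move=> m0 idA0 A0m PrA0; have [F [phi phiP]] := finite_residues galL m0.
pose sig (A : set L) := [set f : F | `[< exists2 a, A a & phi a = f >]]%SET.
pose Q n := `[< exists A, [/\ ideal A, A m%:R, Pr A & #|sig A| = n] >].
have exQ : exists n, Q n by exists #|sig A0|; apply/asboolP; exists A0.
have ubQ n : Q n -> (n <= #|F|)%N by move=> /asboolP[A [_ _ _ <-]]; exact: max_card.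
case: (ex_maxnP exQ ubQ) => n /asboolP[A [idA Am PrA An]] nmax.
exists A; split => // B idB PrB AB b Bb.
have sAB : sig A \subset sig B.
  apply/fintype.subsetP => f; rewrite !finset.inE => /asboolP[a Aa af].
  by apply/asboolP; exists a; [exact: AB | exact: af].
have sE : sig A = sig B.
  apply/eqP; rewrite eqEcard sAB /= An; apply: nmax.
  by apply/asboolP; exists B; split => //; exact: AB.
have : phi b \in sig A by rewrite sE finset.inE; apply/asboolP; exists b.
rewrite finset.inE => /asboolP[a Aa ab].
have [Ai _ AD AM] := idA; have [Bi _ _ _] := idB.
have [z iz zE] := phiP _ _ (Bi _ Bb) (Ai _ Aa) (esym ab).
by rewrite -(subrK a b) zE mulrC; apply: AD => //; exact: AM.
Qed.

Lemma ideal_in_finite_prime A x : ideal A -> A x -> x != 0 -> ~ A 1 ->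
  exists2 Q, finite_prime Q & A `<=` Q.
Proof.
move=> idA Ax x0 A1; have [m m0 Am] := ideal_nat idA Ax x0.
have [Q [idQ Qm [AQ Q1] Qmax]] := @maximal_ideal (fun B => A `<=` B /\ ~ B 1) m A m0 idA Am (conj (fun _ => id) A1).
exists Q => //; have [Qi Q0 QD QM] := idQ; split; last first.
  by exists m%:R; split => //; exact: natr_neq0.
split => //; split => // a b ia ib Qab.
have [Qa|Qa] := pselect (Q a); [by left | right].
(* The ideal generated by [Q] and [a]: by maximality it contains 1 when [a] is not in [Q]. *)
pose B := [set y | exists q r, [/\ Q q, integral r & y = q + r * a]].
have idB : ideal B.
  split.
  - by move=> _ [q [r [Qq ir ->]]]; apply: integralD; [exact: Qi | exact: integralM].
  - by exists 0, 0; split; rewrite ?mul0r ?addr0 //; exact: integral_natr _ 0%N.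
  - move=> _ _ [q [r [Qq ir ->]]] [q' [r' [Qq' ir' ->]]].
    exists (q + q'), (r + r'); split; [exact: QD | exact: integralD | by ring].
  - move=> c _ ic [q [r [Qq ir ->]]]; exists (c * q), (c * r).
    by split; [exact: QM | exact: integralM | ring].
have QB : Q `<=` B by move=> q Qq; exists q, 0; split; rewrite ?mul0r ?addr0 //; exact: integral_natr _ 0%N.
have [[q [r [Qq ir e1]]]|nB1] := pselect (B 1).
  have -> : b = b * q + r * (a * b) by rewrite -[LHS]mul1r e1; ring.
  by apply: QD; apply: QM.
case: Qa; apply: (Qmax B) => //; first by split=> // y /AQ /QB.
exists 0, 1; split; [by [] | exact: integral_natr _ 1%N | by rewrite add0r mul1r].
Qed.

Lemma pigeonhole (F : finType) (f : nat -> F) :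
  exists i j, [/\ (i < j)%N, (j <= #|F|)%N & f i = f j].
Proof.
apply: contrapT => h.
have : injective (fun i : 'I_#|F|.+1 => f i).
  move=> i j fij; apply/val_inj; apply/eqP; apply: contraT; rewrite neq_ltn => /orP[] lt; case: h.
    by exists i, j; split => //; rewrite -ltnS.
  by exists j, i; split => //; rewrite -ltnS.
by move=> /leq_card; rewrite card_ord ltnn.
Qed.

Section Prime.
Variable P : set L.
Hypothesis fP : finite_prime P.

Lemma prime_ideal_ideal : ideal P.
Proof. by have [[Pi P0 PD PM _] _] := fP; split. Qed.

Lemma prime_integral x : P x -> integral x.
Proof. by have [Pi _ _ _] := prime_ideal_ideal; exact: Pi. Qed.

Lemma prime_1 : ~ P 1.
Proof. by have [[_ _ _ _ [nP1 _]] _] := fP. Qed.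

Lemma prime_0 : P 0.
Proof. by have [_ P0 _ _] := prime_ideal_ideal. Qed.

Lemma prime_mulr a x : integral a -> P x -> P (a * x).
Proof. by have [_ _ _ PM] := prime_ideal_ideal; exact: PM. Qed.

Lemma prime_add x y : P x -> P y -> P (x + y).
Proof. by have [_ _ PD _] := prime_ideal_ideal; exact: PD. Qed.

Lemma primeM_not a b : integral a -> integral b -> ~ P a -> ~ P b -> ~ P (a * b).
Proof. by have [[_ _ _ _ [_ PMi]] _] := fP => ia ib nPa nPb /PMi[]. Qed.

Lemma primeX_not a n : integral a -> ~ P a -> ~ P (a ^+ n).
Proof.
move=> ia nPa; elim: n => [|n IH]; first exact: prime_1.
by rewrite exprS; apply: primeM_not => //; exact: integralX.
Qed.

Lemma prime_nat : exists2 m : nat, (0 < m)%N & P m%:R.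
Proof. by have [_ [x [Px x0]]] := fP; exact: ideal_nat prime_ideal_ideal Px x0. Qed.

Lemma prime_neq0 x : ~ P x -> x != 0.
Proof. by move=> nPx; apply/eqP => x0; apply: nPx; rewrite x0; exact: prime_0. Qed.

(** Non-zero primes are maximal: two powers of [a] agree modulo some [m] in [P], and primality
    cancels the smaller one. *)
Lemma prime_inverse a : integral a -> ~ P a -> exists2 w, integral w & P (w * a - 1).
Proof.
move=> ia nPa; have [m m0 Pm] := prime_nat.
have [F [phi phiP]] := finite_residues galL m0.
have [i [j [ij _ e]]] := pigeonhole (fun k => phi (a ^+ k)).
have [z iz zE] := phiP _ _ (integralX j ia) (integralX i ia) (esym e).
exists (a ^+ (j - i.+1)); first exact: integralX.
rewrite -exprSr subnSK //.
have iaji : integral (a ^+ (j - i) - 1) by apply: integralB; [exact: integralX | exact: integral_natr _ 1%N].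
apply: contrapT => nP; apply: (primeM_not (integralX i ia) iaji (primeX_not (n := i) ia nPa) nP).
rewrite mulrBr mulr1 -exprD subnKC ?(ltnW ij) // zE mulrC.
exact: prime_mulr.
Qed.

End Prime.

Section LocalRing.
Variable P : set L.
Hypothesis fP : finite_prime P.

Definition local_integer (x : L) : Prop :=
  exists a b, [/\ integral a, integral b, ~ P b & x = a / b].

(* A generator [b] of a maximal proper annihilator in [O / m O] yields [z = b / m]
   in the inverse of the fractional ideal [P]. *)
Lemma prime_inverse_element : exists z : L, ~ integral z /\ forall x, P x -> integral (x * z).
Proof.
have [m m0 Pm] := prime_nat fP.
have mN0 : m%:R != 0 :> L by exact: natr_neq0.
pose ann b := [set r : L | integral r /\ integral (r * b / m%:R)].
have ann_ideal b : ideal (ann b).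
  split.
  - by move=> x [].
  - by split; rewrite ?mul0r; exact: integral_natr _ 0%N.
  - by move=> x y [ix xb] [iy yb]; split; rewrite ?mulrDl; exact: integralD.
  - by move=> a x ia [ix xb]; split; rewrite -?mulrA; apply: integralM; rewrite ?mulrA.
have ann_m b : integral b -> ann b m%:R.
  by move=> ib; split; [exact: integral_natr | rewrite mulrAC divff // mul1r].
(* Only annihilators inside [P] compete. The maximal one turns out to be prime and, non-zero primes
   being maximal, equal to [P]. *)
pose Pr (A : set L) := A `<=` P /\ exists2 b, integral b & A = ann b.
have Pr1 : Pr (ann 1).
  split; last by exists 1 => //; exact: integral_natr _ 1%N.
  move=> r [ir]; rewrite mulr1 => h; rewrite -(divfK mN0 r).
  exact: prime_mulr.
have [A [idA Am [AP [b ib AE]] Amax]] := maximal_ideal m0 (ann_ideal 1) (ann_m 1 (integral_natr _ 1%N)) Pr1.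
exists (b / m%:R).
have A_prime x y : integral x -> integral y -> A (x * y) -> A x \/ A y.
  move=> ix iy Axy; have [Ax|nAx] := pselect (A x); [by left | right].
  have sub c : integral c -> A `<=` ann (c * b).
    move=> ic r; rewrite AE => -[ir rb]; split => //.
    by rewrite mulrCA -mulrA; apply: integralM => //; rewrite mulrA.
  have [annP|] := pselect (ann (x * b) `<=` P).
    have := Amax _ (ann_ideal (x * b)) (conj annP (ex_intro2 _ _ _ (integralM ix ib) erefl)) (sub x ix).
    apply; split => //; move: Axy; rewrite AE => -[_].
    by rewrite (mulrC x) !mulrA.
  (* Some [s] outside [P] kills [x * b] modulo [m]. The annihilator of [s * b] is then still inside
     [P], and it contains both [A] and [x]; maximality puts [x] in [A]. *)
  move=> /existsNP[s /not_implyP[[is_ sxb] nPs]].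
  case: nAx.
  have annP : ann (s * b) `<=` P.
    move=> r [ir rsb]; apply: contrapT => nPr.
    apply: (primeM_not fP ir is_ nPr nPs); apply: AP; rewrite AE.
    by split; [exact: integralM | rewrite -[r * s * b]mulrA].
  have := Amax _ (ann_ideal (s * b)) (conj annP (ex_intro2 _ _ _ (integralM is_ ib) erefl)) (sub s is_).
  by apply; split => //; move: sxb; rewrite mulrCA.
have PA : P `<=` A.
  move=> x Px.
  apply: contrapT => nAx.
  have fA : finite_prime A.
    have [Ai A0 AD AM] := idA; split; last by exists m%:R.
    by split => //; split => //; move=> /AP; exact: (prime_1 fP).
  have [w iw Aw] := prime_inverse fA (prime_integral fP Px) nAx.
  apply: (prime_1 fP); have -> : 1 = w * x - (w * x - 1) by rewrite opprB addrC subrK.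
  by apply: idealB; [exact: prime_ideal_ideal | exact: prime_mulr | exact: AP].
split; last by move=> x /PA; rewrite AE => -[_]; rewrite mulrA.
move=> ibm; apply: (prime_1 fP); apply: AP; rewrite AE; split; first exact: integral_natr _ 1%N.
by rewrite mul1r.
Qed.
End LocalRing.
End Ideals.

(** * The valuation of a finite prime *)

Section Valuations.
Variable L : splittingFieldType rat.
Notation G := (gal_of {:L}).
Hypothesis galL : galois 1%VS {:L}.

Definition uniformizer (P : set L) (pi : L) : Prop :=
  [/\ P pi, pi != 0 & forall a, P a -> local_integer P (a / pi)].

Section OnePrime.
Variable P : set L.
Hypothesis fP : finite_prime P.

Lemma unit_at_neq0 x : unit_at P x -> x != 0.
Proof.
move=> [a [b [_ _ nPa nPb ->]]]; rewrite mulf_neq0 ?invr_eq0 //; exact: (prime_neq0 fP).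
Qed.

Lemma unit_at1 : unit_at P 1.
Proof.
by exists 1, 1; split; rewrite ?divr1 //; try exact: integral_natr _ 1%N; exact: (prime_1 fP).
Qed.

Lemma unit_atM x y : unit_at P x -> unit_at P y -> unit_at P (x * y).
Proof.
move=> [a [b [ia ib nPa nPb ->]]] [a' [b' [ia' ib' nPa' nPb' ->]]].
exists (a * a'), (b * b'); split; rewrite ?mulf_div //; try exact: integralM; exact: (primeM_not fP).
Qed.

Lemma unit_atV x : unit_at P x -> unit_at P x^-1.
Proof. by move=> [a [b [ia ib nPa nPb ->]]]; exists b, a; split; rewrite ?invf_div. Qed.

Lemma unit_atXz x (n : int) : unit_at P x -> unit_at P (x ^ n).
Proof.
move=> ux; have nat_case k : unit_at P (x ^+ k).
  by elim: k => [|k IH]; [exact: unit_at1 | rewrite exprS; exact: unit_atM].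
by case: n => n; rewrite ?NegzE -?invr_expz; [|apply: unit_atV]; exact: nat_case.
Qed.

Lemma unit_at_local x : local_integer P x -> local_integer P x^-1 -> x != 0 -> unit_at P x.
Proof.
move=> [a [b [ia ib nPb e]]] [a' [b' [ia' ib' nPb' e']]] x0.
exists a, b; split => // Pa; apply: (primeM_not fP ib ib' nPb nPb').
have b0 := prime_neq0 fP nPb; have b'0 := prime_neq0 fP nPb'.
have -> : b * b' = a' * a.
  rewrite e in e'; apply: (mulIf (_ : (a * b')^-1 != 0)).
    by rewrite invr_eq0 mulf_neq0 //; apply: contra_neq x0 => a0; rewrite e a0 mul0r.
  have a0 : a != 0 by apply: contra_neq x0 => a0; rewrite e a0 mul0r.
  rewrite invf_div in e'.
  by transitivity (b / a); [field; rewrite a0 b'0 | rewrite e'; field; rewrite a0 b'0].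
exact: prime_mulr.
Qed.

Lemma unit_at_prime_not x : unit_at P x -> ~ P x.
Proof.
move=> [a [b [ia ib nPa nPb e]]] Px; apply: nPa.
rewrite -(divfK (prime_neq0 fP nPb) a) -e mulrC; exact: prime_mulr.
Qed.

(** If [z] multiplied [P] into itself, it would be almost integral. So [pi * z] is outside [P] for
    some [pi] in [P], and [a / pi = (a z) / (pi z)] has a denominator prime to [P]. *)
Lemma uniformizer_exists : exists2 pi, uniformizer P pi &
  forall a, integral a -> a != 0 -> exists j : nat, unit_at P (a / pi ^+ j).
Proof.
have [z [niz hz]] := prime_inverse_element galL fP.
have [pi Ppi nPu] : exists2 pi, P pi & ~ P (pi * z).
  apply: contrapT => /forall2NP h; apply: niz; apply: almost_integral_integral => //.
  have [m m0 Pm] := prime_nat galL fP; exists m => // k.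
  apply: (prime_integral fP).
  elim: k => [|k IH]; first by rewrite mulr1.
  by have [//|/contrapT] := h (m%:R * z ^+ k); rewrite exprSr mulrA.
have iu : integral (pi * z) by exact: hz.
have u0 := prime_neq0 fP nPu.
have /andP[pi0 z0] : (pi != 0) && (z != 0) by rewrite -negb_or -mulf_eq0.
exists pi.
  split => // a Pa; exists (a * z), (pi * z); split => //; first exact: hz.
  by rewrite -mulf_div divff // mulr1.
move=> a ia a0; apply: contrapT => /forallNP h.
(* As long as no quotient by a power of [pi] is a unit, multiplying by [z] stays in [P]. If this
   never stopped, [a], and so a positive integer, would clear the denominators of all powers of
   [z]. *)
have Paz j : P (a * z ^+ j).
  elim: j => [|j IH].
    rewrite mulr1; apply: contrapT => nPa; apply: (h 0%N); rewrite divr1.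
    exists a, 1; split; rewrite ?divr1 //; [exact: integral_natr _ 1%N | exact: (prime_1 fP)].
  apply: contrapT => nP; apply: (h j.+1).
  exists (a * z ^+ j.+1), ((pi * z) ^+ j.+1); split => //.
  - by rewrite exprSr mulrA; exact: hz.
  - exact: integralX.
  - exact: (primeX_not fP).
  - by rewrite exprMn -mulf_div divff ?mulr1 // expf_neq0.
apply: niz; apply: almost_integral_integral => //.
have [m m0 [y iy e]] := nat_multiple galL ia a0; exists m => // k.
by rewrite e -mulrA; apply: integralM => //; exact: (prime_integral fP).
Qed.

Lemma uniformizer_unit pi pi' : uniformizer P pi -> uniformizer P pi' -> unit_at P (pi / pi').
Proof.
move=> [Pp p0 hp] [Pp' p0' hp']; apply: unit_at_local; first exact: hp'.
  by rewrite invf_div; exact: hp.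
by rewrite mulf_neq0 ?invr_eq0.
Qed.

Lemma uniformizer_ord pi x : uniformizer P pi -> x != 0 -> exists j : int, unit_at P (x / pi ^ j).
Proof.
move=> up x0; have [pi0 up0 h0] := uniformizer_exists.
have [d d0 id] := integral_multiple galL x.
have dN0 : d%:R != 0 :> L by exact: natr_neq0.
have [i ui] := h0 _ id (mulf_neq0 dN0 x0).
have [j uj] := h0 _ (integral_natr _ d) dN0.
exists (i%:Z - j%:Z).
have [_ p0 _] := up; have [_ p00 _] := up0.
have -> : x / pi ^ (i%:Z - j%:Z) =
    (d%:R * x / pi0 ^+ i) * (d%:R / pi0 ^+ j)^-1 * (pi0 / pi) ^ (i%:Z - j%:Z).
  rewrite expfzMl exprz_inv -invr_expz !expfzDr // -!invr_expz -!exprnP.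
  by field; rewrite dN0 !expf_neq0.
apply: unit_atM; first by apply: unit_atM => //; exact: unit_atV.
by apply: unit_atXz; exact: uniformizer_unit.
Qed.

Lemma unit_at_uniformizerX pi (j : int) : uniformizer P pi -> unit_at P (pi ^ j) -> j = 0.
Proof.
move=> [Pp p0 _].
have nat_case k : unit_at P (pi ^+ k) -> k = 0%N.
  case: k => // k /unit_at_prime_not []; rewrite exprSr.
  by apply: prime_mulr => //; apply: integralX; exact: prime_integral Pp.
case: j => j; first by move=> /nat_case ->.
by rewrite NegzE -invr_expz => /unit_atV; rewrite invrK => /nat_case.
Qed.
End OnePrime.

(** Independent of the uniformizer by [ordE]. For a finite prime no [j] qualifies at [x = 0], where
    the value is the default 0; hence the non-vanishing hypotheses below. *)
Definition ord (P : set L) (x : L) : int :=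
  xget 0 [set j : int | exists2 pi, uniformizer P pi & unit_at P (x / pi ^ j)].

Section Ord.
Variable P : set L.
Hypothesis fP : finite_prime P.

Lemma ordE pi x (j : int) : uniformizer P pi -> unit_at P (x / pi ^ j) -> ord P x = j.
Proof.
move=> up ux; rewrite /ord; case: xgetP => [k _ [pi' up' ux']|]; last first.
  by move=> /(_ j) []; exists pi.
have [_ p0 _] := up; have [_ p0' _] := up'.
have : unit_at P (pi ^ (j - k)).
  have -> : pi ^ (j - k) = (x / pi' ^ k) * (x / pi ^ j)^-1 * (pi' / pi) ^ k.
    have x0 : x != 0.
      by have := unit_at_neq0 fP ux; apply: contra_neq => ->; rewrite mul0r.
    rewrite expfzDr // expfzMl exprz_inv -invr_expz.
    by field; rewrite x0 !expfz_neq0.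
  apply: unit_atM => //; first by apply: unit_atM => //; exact: unit_atV.
  by apply: unit_atXz => //; exact: uniformizer_unit.
by move=> /(unit_at_uniformizerX fP up) /eqP; rewrite subr_eq0 => /eqP.
Qed.

Lemma ordP pi x : uniformizer P pi -> x != 0 -> unit_at P (x / pi ^ ord P x).
Proof. by move=> up x0; have [j uj] := uniformizer_ord fP up x0; rewrite (ordE up uj). Qed.

Lemma ordM x y : x != 0 -> y != 0 -> ord P (x * y) = ord P x + ord P y.
Proof.
move=> x0 y0; have [pi up _] := uniformizer_exists fP.
apply: (ordE up); have [_ p0 _] := up.
by rewrite expfzDr // -mulf_div; apply: unit_atM => //; exact: ordP.
Qed.

Lemma ord1 : ord P 1 = 0.
Proof.
have [pi up _] := uniformizer_exists fP.
by apply: (ordE up); rewrite divr1; exact: unit_at1.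
Qed.

Lemma ordV x : x != 0 -> ord P x^-1 = - ord P x.
Proof.
move=> x0; apply/eqP; rewrite -addr_eq0 -ordM ?invr_eq0 // mulVf //.
by apply/eqP; exact: ord1.
Qed.

Lemma ordXz x (n : int) : x != 0 -> ord P (x ^ n) = ord P x * n.
Proof.
move=> x0; have nat_case k : ord P (x ^+ k) = ord P x * k%:Z.
  elim: k => [|k IH]; first by rewrite expr0 ord1 mulr0.
  by rewrite exprS ordM ?expf_neq0 // IH intS mulrDr mulr1.
case: n => n; first exact: nat_case.
by rewrite NegzE -invr_expz ordV ?expfz_neq0 // -exprnP nat_case mulrN.
Qed.

Lemma ord_prod (J : Type) (r : seq J) (f : J -> L) : (forall j, f j != 0) ->
  ord P (\prod_(j <- r) f j) = \sum_(j <- r) ord P (f j).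
Proof.
move=> f0; elim: r => [|j r IH]; first by rewrite !big_nil ord1.
rewrite !big_cons ordM ?IH //; elim: (r) => [|k s IHs]; first by rewrite big_nil oner_eq0.
by rewrite big_cons mulf_neq0.
Qed.

Lemma ord_unit x : x != 0 -> ord P x = 0 <-> unit_at P x.
Proof.
move=> x0; have [pi up _] := uniformizer_exists fP.
split=> [e|u]; last by apply: (ordE up); rewrite divr1.
by have := ordP up x0; rewrite e divr1.
Qed.

Lemma ord_integral x : integral x -> x != 0 -> 0 <= ord P x.
Proof.
move=> ix x0; have [pi up h] := uniformizer_exists fP.
by have [j uj] := h x ix x0; rewrite (ordE up (j := j%:Z)).
Qed.

Lemma ord_gt0 x : P x -> x != 0 -> 0 < ord P x.
Proof.
move=> Px x0; rewrite lt_def; apply/andP; split; last exact: ord_integral (prime_integral fP Px) x0.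
by apply/eqP => /(ord_unit x0) /(unit_at_prime_not fP).
Qed.

Lemma ord_uniformizer pi : uniformizer P pi -> ord P pi = 1.
Proof. by move=> up; apply: (ordE up); rewrite expr1z divff; [exact: unit_at1|case: up]. Qed.

Lemma ord_not_prime x : integral x -> ~ P x -> ord P x = 0.
Proof.
move=> ix nPx; apply/ord_unit; first exact: (prime_neq0 fP).
exists x, 1; split; rewrite ?divr1 //; [exact: integral_natr _ 1%N | exact: (prime_1 fP)].
Qed.

Lemma local_integer_ord x : x != 0 -> local_integer P x <-> 0 <= ord P x.
Proof.
move=> x0; have [pi up h] := uniformizer_exists fP; split.
  move=> [a [b [ia ib nPb e]]]; have b0 := prime_neq0 fP nPb.
  have a0 : a != 0 by apply: contra_neq x0 => a0; rewrite e a0 mul0r.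
  by rewrite e ordM ?invr_eq0 // ordV // (ord_not_prime ib nPb) subr0 ord_integral.
move=> o0; have [a [b [ia ib nPa nPb e]]] := ordP up x0.
have [Pp p0 _] := up.
exists (a * pi ^ ord P x), b; split => //.
  by case: (ord P x) o0 => // n _; apply: integralM => //; apply: integralX; exact: (prime_integral fP).
by rewrite mulrAC -e divfK // expfz_neq0.
Qed.
End Ord.
End Valuations.

(** * Galois action and finiteness of the class number *)

Lemma unit_interval_dist (F : realFieldType) (u v u' v' : F) :
  u' <= u < u' + 1 -> v' <= v < v' + 1 -> `|(u - u') - (v - v')| <= 1.
Proof. by move=> /andP[h1 h2] /andP[h3 h4]; rewrite ler_norml; apply/andP; split; lra. Qed.

Section Galois.
Variable L : splittingFieldType rat.
Notation G := (gal_of {:L}).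
Hypothesis galL : galois 1%VS {:L}.

Lemma gactE (g : G) (P : set L) y : gact g P y = P ((g^-1)%g y).
Proof.
apply/propext; split=> [[x Px <-]|Py]; first by rewrite galKf.
by exists ((g^-1)%g y); rewrite ?galKVf.
Qed.

Lemma gact_mem (g : G) (P : set L) x : gact g P (g x) = P x.
Proof. by rewrite gactE galKf. Qed.

Lemma gactM (g h : G) (P : set L) : gact h (gact g P) = gact (g * h)%g P.
Proof. by apply/seteqP; split=> x; rewrite !gactE invgM galMf. Qed.

Lemma gact1 (P : set L) : gact 1%g P = P.
Proof. by apply/seteqP; split=> x; rewrite gactE invg1 gal1f. Qed.

Lemma finite_prime_gact (g : G) (P : set L) : finite_prime P -> finite_prime (gact g P).
Proof.
move=> fP; have [_ [x [Px x0]]] := fP; split; last first.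
  by exists (g x); rewrite gact_mem fmorph_eq0.
split.
- by move=> _ [y Py <-]; apply: integral_gal; exact: prime_integral Py.
- by rewrite gactE rmorph0; exact: prime_0.
- by move=> a b; rewrite !gactE rmorphD; exact: prime_add.
- move=> a b ia; rewrite !gactE rmorphM; apply: prime_mulr => //; exact: integral_gal.
- split; first by rewrite gactE rmorph1; exact: prime_1.
  move=> a b ia ib; rewrite !gactE rmorphM /=.
  by have [[_ _ _ _ [_ h]] _] := fP; apply: h; exact: integral_gal.
Qed.

Lemma unit_at_gact (g : G) (P : set L) x : unit_at P x -> unit_at (gact g P) (g x).
Proof.
move=> [a [b [ia ib nPa nPb ->]]]; exists (g a), (g b).
by rewrite !gact_mem fmorph_div; split => //; exact: integral_gal.
Qed.

Lemma uniformizer_gact (g : G) (P : set L) x : uniformizer P x -> uniformizer (gact g P) (g x).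
Proof.
move=> [Px x0 h]; split; [by rewrite gact_mem | by rewrite fmorph_eq0 | ].
move=> a; rewrite gactE => /h[b [c [ib ic nPc e]]].
exists (g b), (g c); rewrite gact_mem; split => //; try exact: integral_gal.
by rewrite -fmorph_div -e fmorph_div /= galKVf.
Qed.

Lemma ord_gact (g : G) (P : set L) x : finite_prime P -> x != 0 ->
  ord (gact g P) (g x) = ord P x.
Proof.
move=> fP x0; have [pi up _] := uniformizer_exists galL fP.
apply: (ordE (finite_prime_gact g fP) (uniformizer_gact g up)).
have -> : g x / g pi ^ ord P x = g (x / pi ^ ord P x) by rewrite fmorph_div /= fmorphXz.
by apply: unit_at_gact; apply: ordP.
Qed.

(** The denominators of [x] form an ideal. If it were proper it would lie in a prime [Q], yet [x]
    has a denominator outside [Q]. *)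
Lemma unit_at_all_integral (x : L) : (forall Q, finite_prime Q -> unit_at Q x) -> integral x.
Proof.
move=> ux; pose A := [set b : L | integral b /\ integral (b * x)].
have idA : ideal A.
  split.
  - by move=> a [].
  - by split; rewrite ?mul0r; exact: integral_natr _ 0%N.
  - by move=> a b [ia iax] [ib ibx]; split; rewrite ?mulrDl; exact: integralD.
  - by move=> a b ia [ib ibx]; split; rewrite -?mulrA; exact: integralM.
have [D D0 iDx] := integral_multiple galL x.
have AD : A D%:R by split => //; exact: integral_natr.
have DN0 : D%:R != 0 :> L by exact: natr_neq0.
have [[_]|A1] := pselect (A 1); first by rewrite mul1r.
have [Q fQ AQ] := ideal_in_finite_prime galL idA AD DN0 A1.
have [a [b [ia ib nQa nQb xE]]] := ux Q fQ; case: (nQb); apply: AQ; split => //.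
by rewrite xE mulrC divfK // (prime_neq0 fQ).
Qed.

Lemma finite_prime_comax (P Q : set L) : finite_prime P -> finite_prime Q -> P <> Q ->
  exists2 r, P r & ~ Q r.
Proof.
move=> fP fQ PQ; apply: contrapT => /forall2NP h.
have {}h : P `<=` Q by move=> r Pr; have [//|/contrapT] := h r.
apply: PQ; apply/seteqP; split => // x Qx; apply: contrapT => nPx.
have [w iw Pw] := prime_inverse galL fP (prime_integral fQ Qx) nPx.
apply: (prime_1 fQ); have -> : 1 = w * x - (w * x - 1) by rewrite opprB addrC subrK.
apply: idealB; [exact: prime_ideal_ideal | exact: prime_mulr | exact: h].
Qed.

Section Embedding.
Variables (R : realType) (iota : {rmorphism L -> R[i]}).

Lemma norm_iota_rat (r : rat) : `|iota r%:A| = ratr `|r|.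
Proof.
have -> : iota r%:A = ratr r by exact: (fmorph_eq_rat (iota \o in_alg L) r).
by rewrite ratr_norm.
Qed.

(** Dirichlet's pigeonhole principle on the multiples of [x]. [K] exceeds the total size of the
    generators under all embeddings, so coordinates of size at most [1 / K] give images of norm
    below 1. *)
Lemma simultaneous_approximation : exists2 M : nat, (0 < M)%N &
  forall x : L, exists2 t : nat, (0 < t <= M)%N &
    exists2 w, integral w & forall g : G, `|iota (g (t%:R * x - w))| < 1.
Proof.
have [n [b [ib gen]]] := integral_generators galL.
have [K hK] := @complex_archi R (\sum_(g : G) \sum_i `|iota (g (b i))|)
   (sumr_ge0 _ (fun g _ => sumr_ge0 _ (fun i _ => normr_ge0 _))).
have K0 : (0 < K)%N.
  by rewrite -(ltr0n R[i]); apply: le_lt_trans hK; apply: sumr_ge0 => g _; apply: sumr_ge0.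
have Kr0 : K%:R != 0 :> rat by rewrite pnatr_eq0 -lt0n.
exists #|{ffun 'I_n -> 'I_K.-1.+1}|; first by rewrite card_ffun expn_gt0 card_ord.
move=> x; have [q qE] := gen x.
pose fl t i := Num.floor (K%:R * t%:R * q i).
(* The floor of [K t q_i] modulo [K] tells which of the [K] intervals of length [1 / K] contains the
   fractional part of [t q_i]. *)
have [s [t [st tM /ffunP e]]] := pigeonhole (fun t : nat =>
  [ffun i => inord `|(fl t i %% K%:Z)%Z|%N : 'I_K.-1.+1]).
exists (t - s)%N; first by rewrite subn_gt0 st /= (leq_trans _ tM) // leq_subr.
have hk i : exists k : int, fl t i - fl s i = K%:Z * k.
  have /(congr1 val) := e i; rewrite !ffunE /= !inordK ?prednK //; last 2 first.
  - by rewrite -ltz_nat gez0_abs ?modz_ge0 ?ltz_pmod // -lt0n.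
  - by rewrite -ltz_nat gez0_abs ?modz_ge0 ?ltz_pmod // -lt0n.
  move=> /(congr1 Posz); rewrite !gez0_abs ?modz_ge0 -?lt0n // => /esym/eqP.
  by rewrite eqz_mod_dvd => /dvdzP[k kE]; exists k; rewrite kE mulrC.
have [k kE] := choice hk.
exists (\sum_i (k i)%:~R * b i).
  by apply: (subring_pred_sum (integral_subring L)) => i _; apply: integralM => //; exact: integral_intr.
pose r i := (t - s)%:R * q i - (k i)%:~R.
have rE : (t - s)%:R * x - \sum_i (k i)%:~R * b i = \sum_i (r i)%:A * b i.
  rewrite qE mulr_sumr -sumrB; apply: eq_bigr => i _.
  by rewrite /r -[(_ - _)%:A]/(in_alg L _) rmorphB rmorphM rmorph_nat rmorph_int mulrBl mulrA.
have rK i : `|r i| <= K%:R^-1.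
  have : `|K%:R * r i| <= 1.
    have -> : K%:R * r i = (K%:R * t%:R * q i - (fl t i)%:~R) - (K%:R * s%:R * q i - (fl s i)%:~R).
      rewrite /r natrB ?(ltnW st) // mulrBr.
      have -> : K%:R * (k i)%:~R = (fl t i)%:~R - (fl s i)%:~R :> rat.
        by rewrite -rmorphB /= kE rmorphM /=.
      by ring.
    have := floor_itv (K%:R * t%:R * q i); have := floor_itv (K%:R * s%:R * q i).
    rewrite -/(fl t i) -/(fl s i) !intrD => hs ht; exact: unit_interval_dist.
  by rewrite normrM normr_nat mulrC -ler_pdivlMr ?ltr0n // div1r.
move=> g; rewrite rE !rmorph_sum.
apply: le_lt_trans (ler_norm_sum _ _ _) _.
apply: le_lt_trans (_ : K%:R^-1 * \sum_(h : G) \sum_i `|iota (h (b i))| < 1); last first.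
  by rewrite mulrC ltr_pdivrMr ?ltr0n // mul1r.
rewrite (bigD1 g) //= mulrDr.
apply: le_trans (_ : K%:R^-1 * \sum_i `|iota (g (b i))| <= _); last first.
  by rewrite lerDl mulr_ge0 ?invr_ge0 // sumr_ge0 // => h _; apply: sumr_ge0.
rewrite mulr_sumr; apply: ler_sum => i _.
rewrite rmorphM rmorphM normrM ler_wpM2r //.
suff : `|iota (g (r i)%:A)| <= K%:R^-1 by [].
have -> : g (r i)%:A = (r i)%:A by rewrite linearZ /= rmorph1.
rewrite norm_iota_rat -(ratr_nat _ K) -fmorphV ler_rat; exact: rK.
Qed.

Lemma norm_iota_lt (x b : L) : b != 0 -> (forall g : G, `|iota (g x)| < 1) ->
  `|iota (norm (x * b))| < `|iota (norm b)|.
Proof.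
move=> b0 hx; rewrite normM rmorphM normrM gtr_pMl; last first.
  by rewrite normr_gt0 fmorph_eq0 norm_eq0.
rewrite /norm rmorph_prod normr_prod (bigD1 (1%g : G)) //=.
apply: le_lt_trans (hx 1%g); rewrite ler_piMr //.
by apply: prodr_ile1 => g; rewrite normr_ge0 ltW.
Qed.

(* Hurwitz's form of the finiteness of the class number. *)
Lemma ideal_classes_finite (J : nat -> set L) :
  (forall n, ideal (J n)) -> (forall n, exists2 a, J n a & a != 0) ->
  exists n m y, [/\ (n < m)%N, y != 0 & forall a, J n a <-> J m (y * a)].
Proof.
move=> idJ J0; have [M M0 hM] := simultaneous_approximation.
have min_norm n : exists b, [/\ J n b, b != 0 &
    forall a, J n a -> a != 0 -> `|iota (norm b)| <= `|iota (norm a)|].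
  pose Q k := `[< exists b, [/\ J n b, b != 0 & `|iota (norm b)| = k%:R] >].
  have natQ b : J n b -> b != 0 -> exists k : nat, `|iota (norm b)| = k%:R.
    have [iJ _ _ _] := idJ n.
    move=> /iJ ib _; have [z zE] := norm_integral galL ib; exists `|z|%N.
    by rewrite zE rmorph_int -intr_norm pmulrn abszE.
  have exQ : exists k, Q k.
    have [b Jb b0] := J0 n; have [k kE] := natQ b Jb b0.
    by exists k; apply/asboolP; exists b.
  case: (ex_minnP exQ) => k /asboolP[b [Jb b0 bk]] kmin.
  exists b; split => // a Ja a0; have [l lE] := natQ a Ja a0.
  by rewrite bk lE ler_nat; apply: kmin; apply/asboolP; exists a.
have [b hb] := choice min_norm.
have B0 : (0 < M`!)%N := fact_gt0 M.
have BN0 : M`!%:R != 0 :> L by exact: natr_neq0.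
(* The remainder [t a - w b] lies in the ideal and has smaller norm than the minimal element [b n],
   so it vanishes: [a / b n = w / t], and [t] divides the factorial of [M]. *)
have Jint n a : J n a -> integral (M`!%:R * a / b n).
  move=> Ja; have [Jb b0 bmin] := hb n.
  have [t /andP[t0 tM] [w iw hw]] := hM (a / b n).
  have [Ji _ JD JM] := idJ n.
  pose e := t%:R * a - w * b n.
  have Je : J n e.
    by apply: idealB => //; apply: JM => //; exact: integral_natr.
  have eE : e = (t%:R * (a / b n) - w) * b n by rewrite mulrBl -mulrA divfK.
  have e0 : e = 0.
    apply/eqP; apply: contraT => e0.
    have := bmin e Je e0; rewrite eE => /le_lt_trans/(_ (norm_iota_lt b0 hw)).
    by rewrite ltxx.
  have /dvdnP[u uE] : (t %| M`!)%N by rewrite dvdn_fact // t0.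
  have -> : M`!%:R * a / b n = u%:R * w.
    rewrite uE natrM; move/eqP: e0; rewrite subr_eq0 => /eqP e0.
    by rewrite -!mulrA (mulrA t%:R) e0 mulfK.
  by apply: integralM => //; exact: integral_natr.
have [F [phi phiP]] := finite_residues galL B0.
(* The rescaled ideal is integral and contains the factorial of [M], the image of [b n]; its
   residues therefore determine it. *)
pose sig n := [set f : F | `[< exists2 a, J n a & phi (M`!%:R * a / b n) = f >]]%SET.
have [n [m [nm _ sE]]] := pigeonhole sig.
have transfer n1 m1 a : sig n1 = sig m1 -> J n1 a -> J m1 (b m1 / b n1 * a).
  move=> e Ja.
  have : phi (M`!%:R * a / b n1) \in sig n1 by rewrite finset.inE; apply/asboolP; exists a.
  rewrite e finset.inE => /asboolP[a' Ja' e'].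
  have [z iz zE] := phiP _ _ (Jint _ _ Ja) (Jint _ _ Ja') (esym e').
  have [_ b0 _] := hb n1; have [Jb' b0' _] := hb m1.
  have -> : b m1 / b n1 * a = a' + z * b m1.
    apply: (mulfI BN0); apply: (mulIf (_ : (b m1)^-1 != 0)); first by rewrite invr_eq0.
    transitivity (M`!%:R * a / b n1); first by field; rewrite b0 b0'.
    rewrite -[LHS](subrK (M`!%:R * a' / b m1)) zE; by field.
  by have [_ _ JD JM] := idJ m1; apply: JD => //; exact: JM.
have [_ bn0 _] := hb n; have [_ bm0 _] := hb m.
exists n, m, (b m / b n); split => //; first by rewrite mulf_neq0 ?invr_eq0.
move=> a; split; first exact: transfer.
move=> /(transfer _ _ _ (esym sE)).
have -> : b n / b m * (b m / b n * a) = a; last by [].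
by field; rewrite bn0 bm0.
Qed.

(** Two powers of [P], of exponents [n < m], lie in the same ideal class. The factor [y] between
    them generates the power of exponent [m - n]. *)
Lemma isolating_element (P : set L) : finite_prime P -> exists y,
  [/\ y != 0, 0 < ord P y & forall Q, finite_prime Q -> Q <> P -> ord Q y = 0].
Proof.
move=> fP; have [pi up _] := uniformizer_exists galL fP.
have [Pp p0 _] := up.
(* The [n]-th power of [P], described locally: its non-zero elements are the integers of valuation
   at least [n]. *)
pose J n := [set a : L | integral a /\ local_integer P (a / pi ^+ n)].
have idJ n : ideal (J n).
  split.
  - by move=> a [].
  - split; first exact: integral_natr _ 0%N.
    exists 0, 1; split; rewrite ?mul0r //; try exact: integral_natr _ 1%N.
      exact: integral_natr _ 0%N.
    exact: (prime_1 fP).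
  - move=> x y [ix [a [b [ia ib nPb e]]]] [iy [a' [b' [ia' ib' nPb' e']]]].
    split; first exact: integralD.
    exists (a * b' + a' * b), (b * b'); split.
    + by apply: integralD; exact: integralM.
    + exact: integralM.
    + exact: (primeM_not fP).
    + by rewrite mulrDl e e' addf_div // (prime_neq0 fP).
  - move=> c x ic [ix [a [b [ia ib nPb e]]]]; split; first exact: integralM.
    exists (c * a), b; split => //; first exact: integralM.
    by rewrite -[LHS]mulrA e mulrA.
have JE n a : integral a -> a != 0 -> J n a <-> n%:Z <= ord P a.
  move=> ia a0; have pn0 : pi ^+ n != 0 by rewrite expf_neq0.
  have q0 : a / pi ^+ n != 0 by rewrite mulf_neq0 ?invr_eq0.
  have ordq : ord P (a / pi ^+ n) = ord P a - n%:Z.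
    rewrite ordM ?invr_eq0 // ordV // exprnP ordXz // (ord_uniformizer fP up) mul1r //.
  rewrite /J /= local_integer_ord // ordq subr_ge0.
  by split=> [[]|].
have power_mem r n : P r -> r != 0 -> J n (r ^+ n).
  move=> Pr r0; apply/JE; [exact: integralX (prime_integral fP Pr) | by rewrite expf_neq0 | ].
  rewrite exprnP ordXz //; have := ord_gt0 galL fP Pr r0; nia.
have J0 n : exists2 a, J n a & a != 0.
  by exists (pi ^+ n); [exact: power_mem | rewrite expf_neq0].
have [n [m [y [nm y0 yJ]]]] := ideal_classes_finite idJ J0.
exists y; split => //.
  have /yJ Jy := power_mem pi n Pp p0.
  have [iy _] := Jy; move: Jy; rewrite JE ?mulf_neq0 ?expf_neq0 //.
  rewrite ordM ?expf_neq0 // exprnP ordXz // (ord_uniformizer fP up).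
  by lia.
(* With [r] in [P] but not in [Q], both [r ^+ m / y] and [y * r ^+ n] are integral and [r] has
   valuation 0 at [Q], which bounds the valuation of [y] on both sides. *)
move=> Q fQ QP; have [r Pr nQr] := finite_prime_comax fP fQ (nesym QP).
have r0 := prime_neq0 fQ nQr; have ir := prime_integral fP Pr.
have ordr k : ord Q (r ^+ k) = 0.
  by rewrite exprnP ordXz // ord_not_prime // mul0r.
apply/eqP; rewrite eq_le; apply/andP; split.
  have : J n (r ^+ m / y) by apply/yJ; rewrite mulrC divfK //; exact: power_mem.
  move=> [i _]; have q0 : r ^+ m / y != 0 by rewrite mulf_neq0 ?invr_eq0 ?expf_neq0.
  have := ord_integral galL fQ i q0.
  by rewrite ordM ?invr_eq0 ?expf_neq0 // ordV // ordr sub0r oppr_ge0.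
have /yJ[i _] := power_mem r n Pr r0.
have := ord_integral galL fQ i (mulf_neq0 y0 (expf_neq0 n r0)).
by rewrite ordM ?expf_neq0 // ordr addr0.
Qed.
End Embedding.
End Galois.

(** * Units, embeddings and primes over p *)

Section Embeddings.
Variable L : splittingFieldType rat.
Notation G := (gal_of {:L}).
Hypothesis galL : galois 1%VS {:L}.
Variable R : realType.

Lemma embedding_alg (tau : {rmorphism L -> R[i]}) (q : rat) : tau q%:A = ratr q.
Proof. exact: (fmorph_eq_rat (tau \o in_alg L) q). Qed.

Lemma map_embedding_alg (tau : {rmorphism L -> R[i]}) (p : {poly rat}) :
  map_poly tau (map_poly (in_alg L) p) = map_poly (ratr : rat -> R[i]) p.
Proof. by rewrite -map_poly_comp; apply: eq_map_poly => q; exact: embedding_alg. Qed.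

(** For a primitive element [th], [tau th] is a root of the rational polynomial [conj_poly th],
    whose roots under [iota] are the [iota (g th)]. *)
Lemma embedding_gal (iota tau : {rmorphism L -> R[i]}) :
  exists g : G, forall x, tau x = iota (g x).
Proof.
have sepL : separable 1%AS {:L} by case/and3P: galL.
have genL := eq_adjoin_separable_generator sepL (sub1v _).
set th := separable_generator _ _ in genL.
have [g gth] : exists g : G, tau th = iota (g th).
  have [p pm pE] := conj_poly_rat galL th.
  have : root (map_poly iota (conj_poly th)) (tau th).
    rewrite pE map_embedding_alg -(map_embedding_alg tau) -pE fmorph_root.
    exact: root_conj_poly_self.
  rewrite /conj_poly rmorph_prod /root horner_prod => /prodf_eq0[g _].
  rewrite rmorphB /= map_polyX map_polyC hornerXsubC subr_eq0 => /eqP e.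
  by exists g.
exists g => x.
have : x \in <<1%AS; th>>%VS by rewrite -genL memvf.
move=> /Fadjoin_polyP[p /polyOverP p1 ->].
have [q qE] := choice (fun i => (vlineP _ _ (p1 i) : exists k, _)).
have -> : p = map_poly (in_alg L) (\poly_(i < size p) q i).
  apply/polyP => i; rewrite coef_map coef_poly /=; case: ltnP => h; first exact: qE.
  by rewrite nth_default // scale0r.
move: (\poly_(i < size p) q i) => r {p p1 q qE}.
rewrite -[LHS]horner_map map_embedding_alg gth.
have -> : g (map_poly (in_alg L) r).[th] = (map_poly (in_alg L) r).[g th].
  rewrite -[LHS]/(gal_repr g _) -horner_map -map_poly_comp; congr (_.[_]).
  by apply: eq_map_poly => z /=; rewrite linearZ /= rmorph1.
by rewrite -[RHS]horner_map map_embedding_alg.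
Qed.

Variable iota : {rmorphism L -> R[i]}.

Lemma coef_prod_XsubC_le (J : Type) (r : seq J) (a : J -> R[i]) i :
  (forall j, `|a j| <= 1) -> `|(\prod_(j <- r) ('X - (a j)%:P))`_i| <= 2 ^+ size r.
Proof.
move=> a1; elim: r i => [|j r IH] i.
  by rewrite big_nil coef1; case: (i == 0)%N; rewrite ?normr1 ?normr0.
rewrite big_cons mulrBl coefB coefXM coefCM /= exprS mulr_natl mulr2n.
apply: le_trans (ler_normB _ _) _; apply: lerD.
  by case: (i == 0)%N => //; rewrite normr0 exprn_ge0.
by rewrite normrM -[leRHS]mul1r ler_pM.
Qed.

Let unimodular (u : L) := integral u /\ forall g : G, `|iota (g u)| = 1.

(** The coefficients of [conj_poly u] are integers bounded by [2 ^ n]. The label consists of this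
    polynomial and of the automorphism that carries a fixed root of it to [u]. *)
Let unimodular_finite : exists (F : finType) (phi : L -> F),
  forall u v, unimodular u -> unimodular v -> phi u = phi v -> u = v.
Proof.
pose n := size (index_enum G); pose B := (2 ^ n)%N.
have hq (u : L) : exists q : {poly int}, unimodular u -> conj_poly u = map_poly (intr : int -> L) q.
  have [[iu _]|nu] := pselect (unimodular u); last by exists 0.
  by have [q _ qE] := integral_conj_poly galL iu; exists q.
have [q qE] := choice hq.
have qB u i : unimodular u -> `|(q u)`_i| <= B%:Z.
  move=> uu; have [iu u1] := uu.
  have : `|iota (conj_poly u)`_i| <= 2 ^+ n.
    rewrite -coef_map /conj_poly rmorph_prod.
    under eq_bigr => g _ do rewrite rmorphB /= map_polyX map_polyC /=.
    by apply: coef_prod_XsubC_le => g; rewrite u1.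
  rewrite qE // coef_map /= rmorph_int -intr_norm.
  have -> : 2 ^+ n = (B%:Z)%:~R :> R[i] by rewrite -pmulrn natrX.
  by rewrite ler_int.
have qs u i : unimodular u -> (n < i)%N -> (q u)`_i = 0.
  move=> uu ni; apply: (@intr_inj rat); apply: (alg_inj (L := L)); rewrite alg_int.
  have := congr1 (fun p : {poly L} => p`_i) (qE u uu); rewrite coef_map /= => <-.
  by rewrite nth_default ?scale0r // size_prod_XsubC.
have abs_shift (z : int) : `|z| <= B%:Z -> (absz (z + B%:Z)%R < (B.*2).+1)%N.
  rewrite ler_norml => /andP[h1 h2]; rewrite -ltz_nat gez0_abs; first by lia.
  by rewrite -lerBlDr sub0r.
pose code u : {ffun 'I_n.+1 -> 'I_(B.*2).+1} := [ffun i : 'I_n.+1 => inord (absz ((q u)`_i + B%:Z))].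
have codeP u v : unimodular u -> unimodular v -> code u = code v -> conj_poly u = conj_poly v.
  move=> uu uv /ffunP e; rewrite !qE //; congr map_poly; apply/polyP => i.
  have [ni|ni] := ltnP n i; first by rewrite !qs.
  have := congr1 val (e (Ordinal (ni : i < n.+1)%N)); rewrite !ffunE /= !inordK.
  - have := qB u i uu; have := qB v i uv; rewrite !ler_norml => /andP[h1 _] /andP[h2 _].
    by move=> /(congr1 Posz); rewrite !gez0_abs -?lerBlDr ?sub0r // => /addIr.
  - by apply: abs_shift; exact: qB.
  - by apply: abs_shift; exact: qB.
pose rep f := xget 0 [set v | unimodular v /\ code v = f].
have hg (u : L) : exists g : G, unimodular u -> u = g (rep (code u)).
  have [uu|nu] := pselect (unimodular u); last by exists 1%g.
  have [uv cv] : unimodular (rep (code u)) /\ code (rep (code u)) = code u.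
    by rewrite /rep; case: xgetP => [v -> //|/(_ u) []].
  have [|g gE] := @root_conj_poly L (rep (code u)) u; last by exists g.
  by rewrite (codeP _ _ uv uu cv); exact: root_conj_poly_self.
have [g gE] := choice hg.
exists ({ffun 'I_n.+1 -> 'I_(B.*2).+1} * G)%type, (fun u => (code u, g u)).
by move=> u v uu uv [e1 e2]; rewrite (gE u uu) (gE v uv) e1 e2.
Qed.

(** Two powers of [u] with exponents at most [#|F|] coincide, so the order of [u] divides the
    factorial of [#|F|]. Independence of [u] is what later allows passage to the closure. *)
Lemma unimodular_torsion : exists2 N : nat, (0 < N)%N &
  forall u, integral u -> (forall g : G, `|iota (g u)| = 1) -> u ^+ N = 1.
Proof.
have [F [phi phiP]] := unimodular_finite.
exists (#|F|)`!; first exact: fact_gt0.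
move=> u iu u1.
have uX k : unimodular (u ^+ k).
  by split; [exact: integralX | move=> g; rewrite !rmorphXn /= normrX u1 expr1n].
have u0 : u != 0.
  by apply: contra_eq_neq (u1 1%g) => ->; rewrite !rmorph0 normr0 eq_sym oner_eq0.
have [i [j [ij jF e]]] := pigeonhole (fun k => phi (u ^+ k)).
have {}e := phiP _ _ (uX i) (uX j) e.
have e1 : u ^+ (j - i) = 1.
  by apply: (mulfI (expf_neq0 i u0)); rewrite -exprD subnKC ?(ltnW ij) // mulr1.
have /dvdnP[k ->] : (j - i %| (#|F|)`!)%N.
  by rewrite dvdn_fact // subn_gt0 ij (leq_trans (leq_subr _ _)).
by rewrite mulnC exprM e1 expr1n.
Qed.
End Embeddings.

(** * Transitivity of the Galois group on the primes over p *)

Section Transitivity.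
Variable L : splittingFieldType rat.
Notation G := (gal_of {:L}).
Hypothesis galL : galois 1%VS {:L}.
Variable p : nat.
Hypothesis p_prime : prime p.

Lemma prime_over_int (P : set L) (n : int) : prime_over p P -> P n%:~R -> (p%:Z %| n)%Z.
Proof.
move=> [fP Pp] Pn; apply: contraT => ndvd.
have cop : coprime p `|n|%N by rewrite prime_coprime.
have [u [v e]] := Bezoutz p%:Z n.
exfalso; apply: (prime_1 fP).
have -> : 1 = u%:~R * p%:R + v%:~R * n%:~R :> L.
  rewrite pmulrn -!intrM -intrD e /gcdz absz_nat.
  by move: cop; rewrite /coprime => /eqP ->.
by apply: prime_add => //; apply: prime_mulr => //; exact: integral_intr.
Qed.

(** Being a unit means that [p] divides neither term of the reduced fraction, a condition that does
    not see which prime over [p] is taken. *)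
Lemma rat_unit_at_over (P Q : set L) (q : rat) : prime_over p P -> prime_over p Q ->
  q != 0 -> unit_at P q%:A -> unit_at Q q%:A.
Proof.
move=> pP pQ q0 uP; have [fP Pp] := pP; have [fQ Qp] := pQ.
have qE : q%:A = (numq q)%:~R / (denq q)%:~R :> L.
  by rewrite -!alg_int -[_%:A / _]/(in_alg L _ / in_alg L _) -fmorph_div divq_num_den.
have n0 : (numq q)%:~R != 0 :> L.
  by rewrite -alg_int -[_%:A]/(in_alg L _) fmorph_eq0 intr_eq0 numq_eq0.
have d0 : (denq q)%:~R != 0 :> L.
  by rewrite -alg_int -[_%:A]/(in_alg L _) fmorph_eq0 intr_eq0 denq_neq0.
have qN0 : q%:A != 0 :> L by rewrite qE mulf_neq0 ?invr_eq0.
have eord : ord P (numq q)%:~R = ord P (denq q)%:~R.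
  move/(ord_unit galL fP qN0): uP; rewrite qE ordM ?invr_eq0 // ordV // => /eqP.
  by rewrite subr_eq0 => /eqP.
have dvdP (n : int) : (p%:Z %| n)%Z -> P n%:~R.
  by move=> /dvdzP[m ->]; rewrite intrM; apply: prime_mulr => //; exact: integral_intr.
have not_both : ~ ((p%:Z %| numq q)%Z /\ (p%:Z %| denq q)%Z).
  move=> [h1 h2]; have := coprime_num_den q; rewrite /coprime => /eqP g1.
  have : (p %| gcdn `|numq q| `|denq q|)%N by rewrite dvdn_gcd; apply/andP.
  by rewrite g1 dvdn1 => /eqP p1; move: p_prime; rewrite p1.
have num : ~ (p%:Z %| numq q)%Z.
  move=> h; have /negP hd : ~ (p%:Z %| denq q)%Z by move=> h'; exact: not_both.
  have := ord_gt0 galL fP (dvdP _ h) n0; rewrite eord ord_not_prime //.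
    exact: integral_intr.
  by move=> /(prime_over_int pP); apply/negP.
have den : ~ (p%:Z %| denq q)%Z.
  move=> h; have := ord_gt0 galL fP (dvdP _ h) d0; rewrite -eord ord_not_prime //.
    exact: integral_intr.
  by move=> /(prime_over_int pP).
exists (numq q)%:~R, (denq q)%:~R; split => //; try exact: integral_intr.
  by move=> /(prime_over_int pQ).
by move=> /(prime_over_int pQ).
Qed.

Variables (R : realType) (iota : {rmorphism L -> R[i]}).

(** The norm of an element isolating [Q] is rational. If [Q] were not conjugate to [P], it would be
    a unit at [P], hence at [Q], where its valuation is positive. *)
Lemma primes_over_transitive (P Q : set L) : prime_over p P -> prime_over p Q ->
  exists g : G, Q = gact g P.
Proof.
move=> pP pQ; have [fP Pp] := pP; have [fQ Qp] := pQ.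
apply: contrapT => /forallNP hQ.
have [y [y0 yQ yother]] := isolating_element galL iota fQ.
have gy0 (g : G) : g y != 0 by rewrite fmorph_eq0.
have ordg (P' : set L) (g : G) : finite_prime P' -> ord P' (g y) = ord (gact (g^-1)%g P') y.
  move=> fP'; rewrite -[P' in LHS](gact1 P') -(mulVg g) -gactM ord_gact //.
  exact: finite_prime_gact.
have [q qE] := norm_rat galL y.
have ny0 : norm y != 0 by rewrite norm_eq0.
have q0 : q != 0 by apply: contra_neq ny0 => q0; rewrite qE q0 scale0r.
have oP : ord P (norm y) = 0.
  rewrite /norm ord_prod // big1 // => g _; rewrite ordg // yother //.
    exact: finite_prime_gact.
  move=> e; apply: (hQ (g^-1)%g); by rewrite e.
have : unit_at Q (norm y).
  by rewrite qE; apply: (rat_unit_at_over pP) => //; rewrite -qE; apply/(ord_unit galL fP).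
move=> /(ord_unit galL fQ ny0) oQ.
have : 0 < ord Q (norm y).
  rewrite /norm ord_prod // (bigD1 (1%g : G)) //= gal1f ltr_wpDr // sumr_ge0 // => g _.
  rewrite ordg //; have fQ' := finite_prime_gact (g^-1)%g fQ.
  have [->|ne] := pselect (gact (g^-1)%g Q = Q); first exact: ltW.
  by rewrite yother.
by rewrite oQ ltxx.
Qed.
End Transitivity.

(** * Centrality of complex conjugation *)

Section CM.
Variable L : splittingFieldType rat.
Notation G := (gal_of {:L}).
Hypothesis galL : galois 1%VS {:L}.
Variables (R : realType) (iota : {rmorphism L -> R[i]}) (c : G).
Hypothesis CM : is_CM L R.
Hypothesis c_conj : forall x, iota (c x) = (iota x)^*.

Lemma conj_neq1 : exists x, c x != x.
Proof.
have [im _] := CM; have [x hx] := im iota; exists x.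
apply: contraNneq hx => cx; have := c_conj x; rewrite cx => /esym/eqP.
by rewrite -CrealE => /Creal_ImP ->.
Qed.

(** Every conjugate of [c] fixes the totally real subfield [K], whose elements are real in all
    embeddings, and the group fixing [K] has a single non-trivial element. *)
Lemma conj_central (g : G) x : c (g x) = g (c x).
Proof.
have [im [K [dimK real_K]]] := CM.
have galK : galois K {:L} by apply: galoisS galL; rewrite sub1v subvf.
have cardG : #|('Gal({:L} / K))%g| = 2%N by rewrite -(galois_dim galK).
have conj_gal (h : G) : (h * c * h^-1)%g \in ('Gal({:L} / K))%g.
  rewrite gal_kHom ?subvf //; apply/kHomP; split=> [a b _ _|a Ka]; first exact: rmorphM.
  rewrite !galMf; have -> : c (h a) = h a; last by rewrite galKf.
  apply: (fmorph_inj iota); rewrite c_conj; apply/eqP; rewrite -CrealE.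
  apply/Creal_ImP; exact: (real_K (iota \o h) a Ka).
have c1 : c != 1%g by have [y] := conj_neq1; apply: contra_neq => ->; rewrite gal1f.
have cK : c \in ('Gal({:L} / K))%g.
  by have := conj_gal 1%g; rewrite mul1g invg1 mulg1.
have GE : ('Gal({:L} / K))%g = [set (1%g : G); c]%SET.
  apply/esym/eqP; rewrite eqEcard cardG cards2 eq_sym c1 andbT.
  by apply/fintype.subsetP => h; rewrite !finset.inE => /orP[] /eqP ->; rewrite ?group1.
have : (g * c * g^-1)%g \in [set (1%g : G); c]%SET by rewrite -GE.
rewrite !finset.inE => /orP[] /eqP e.
  case/eqP: c1; have := congr1 (fun h => g^-1 * h * g)%g e.
  by rewrite mulg1 mulVg !mulgA mulVg mul1g -mulgA mulVg mulg1.
have {}e : (g * c = c * g)%g by rewrite -[in RHS]e -(mulgA (g * c)%g) mulVg mulg1.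
by have := congr1 (fun h : G => h x) e; rewrite !galMf.
Qed.
End CM.

(** * p-units of a CM field *)

(** Collects the places by fibres of [f], through a chosen representative of each. It is applied
    with [f v] a prime and [phi] the valuation of a fixed element. *)
Lemma grouped_sum (I : finType) (X : Type) (f : I -> X) (w : I -> int) (phi : X -> int) :
  (forall v0, \sum_(v | `[< f v = f v0 >]) w v = 0) -> \sum_v w v * phi (f v) = 0.
Proof.
move=> h; pose r v := odflt v [pick u | `[< f v = f u >]].
have fr v : f (r v) = f v.
  by rewrite /r; case: pickP => [u /asboolP -> //|/(_ v)/asboolP[]].
have rE v v0 : (r v == r v0) = `[< f v = f v0 >].
  apply/eqP/asboolP => [e|e]; first by rewrite -(fr v) e fr.
  rewrite /r (eq_pick (Q := fun u => `[< f v0 = f u >])); last by move=> u /=; rewrite e.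
  by case: pickP => // /(_ v0)/asboolP[].
rewrite (partition_big r xpredT) //= big1 // => j _.
have [v0 /eqP rv0|no] := pickP (fun v => r v == j); last by rewrite big_pred0.
rewrite (eq_bigr (fun v => w v * phi (f v0))); last first.
  by move=> v; rewrite -rv0 rE => /asboolP ->.
rewrite -mulr_suml (eq_bigl (fun v => `[< f v = f v0 >])) ?h ?mul0r //.
by move=> v; rewrite -rv0 rE.
Qed.

Lemma gal_exprz (L : splittingFieldType rat) (g : gal_of {:L}) (x : L) (n : int) : g (x ^ n) = g x ^ n.
Proof. by rewrite fmorphXz. Qed.

Lemma lift_seq (X Y : eqType) (f : Y -> X) (Q : Y -> Prop) (s : seq X) :
  (forall x, x \in s -> exists2 y, Q y & f y = x) ->
  exists2 s', map f s' = s & forall y, y \in s' -> Q y.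
Proof.
elim: s => [|x s IH] h; first by exists [::].
have [s' e h'] := IH (fun y ys => h y (mem_behead (s := x :: s) ys)).
have [y Qy fy] := h x (mem_head _ _).
exists (y :: s'); first by rewrite /= fy e.
by move=> z; rewrite inE => /orP[/eqP ->|/h'].
Qed.

Section Main.
Variables (R : realType) (L : splittingFieldType rat) (p : nat).
Variables (iota : {rmorphism L -> R[i]}) (I : finType).
Variables (sigma : I -> gal_of {:L}) (c : gal_of {:L}) (S : set (set L)).
Notation G := (gal_of {:L}).
Hypothesis galL : galois 1%VS {:L}.
Hypothesis CM : is_CM L R.
Hypothesis p_prime : prime p.
Hypothesis c_conj : forall x, iota (c x) = (iota x)^*.
Hypothesis S_over : forall P, S P -> prime_over p P /\ gact c P <> P.
Hypothesis S_repr : forall P, prime_over p P -> gact c P <> P -> (S P <-> ~ S (gact c P)).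

Let central := conj_central galL CM c_conj.

Lemma conjK x : c (c x) = x.
Proof. by apply: (fmorph_inj iota); rewrite !c_conj conjCK. Qed.

Lemma gact_conjK P : gact c (gact c P) = P.
Proof.
rewrite gactM; have -> : (c * c = 1)%g; last exact: gact1.
by apply/eqP/gal_eqP => x _; rewrite galMf conjK gal1f.
Qed.

Lemma gact_conj_comm (g : G) P : gact c (gact g P) = gact g (gact c P).
Proof.
rewrite !gactM; congr gact.
by apply/eqP/gal_eqP => x _; rewrite !galMf central.
Qed.

Lemma prime_over_gact (g : G) P : prime_over p P -> prime_over p (gact g P).
Proof.
move=> [fP Pp]; split; first exact: finite_prime_gact.
by rewrite gactE rmorph_nat.
Qed.

(** As [c] is central, the squared norm of [tau w] is the image of [w * c w] under every embedding
    [tau]. *)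
Lemma norm_one_unimodular (tau : {rmorphism L -> R[i]}) w : w * c w = 1 -> `|tau w| = 1.
Proof.
move=> w1; have [g ->] := embedding_gal galL iota tau.
apply/eqP; rewrite -(eqrXn2 (n := 2)) // expr1n normCK -c_conj central -rmorphM -rmorphM w1 !rmorph1.
by [].
Qed.

Lemma Ep_neq0 (x : L) : Ep R p x -> x != 0.
Proof. by case. Qed.

Lemma Ep_conj (x : L) : Ep R p x -> x * c x = 1.
Proof.
move=> [_ _ x1]; apply: (fmorph_inj iota).
by rewrite rmorphM c_conj -normCK x1 expr1n rmorph1.
Qed.

Lemma ord_conj P x : finite_prime P -> x != 0 -> x * c x = 1 -> ord (gact c P) x = - ord P x.
Proof.
move=> fP x0 xc; rewrite -{1}(conjK x) ord_gact // ?fmorph_eq0 //.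
apply/eqP; rewrite -addr_eq0 addrC -ordM ?fmorph_eq0 // xc.
by apply/eqP; exact: ord1.
Qed.

Lemma EpM (x y : L) : Ep R p x -> Ep R p y -> Ep R p (x * y).
Proof.
move=> [x0 ux x1] [y0 uy y1]; split; first by rewrite mulf_neq0.
  by move=> Q fQ nQ; apply: unit_atM => //; [exact: ux | exact: uy].
by move=> tau; rewrite rmorphM normrM x1 y1 mulr1.
Qed.

Lemma Ep1 : Ep R p (1 : L).
Proof.
split; first exact: oner_neq0.
  by move=> Q fQ _; exact: unit_at1.
by move=> tau; rewrite rmorph1 normr1.
Qed.

Lemma EpX (x : L) n : Ep R p x -> Ep R p (x ^+ n).
Proof. by move=> Ex; elim: n => [|n IH]; [exact: Ep1 | rewrite exprS; exact: EpM]. Qed.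

Let alpha (x : L) : Tspace R I := fun v => iota (sigma v x).
Let A := alpha_img iota sigma p.
Let Hc := closure A.

Lemma alpha_mem x : Ep R p x -> A (alpha x).
Proof. by move=> Ex; exists x. Qed.

Lemma alpha_Tk : A `<=` @Tk R I.
Proof. by move=> _ [x [_ _ x1] <-] v; exact: (x1 (iota \o sigma v)). Qed.

Lemma alpha_mul z w : A z -> A w -> A (fun v => z v * w v).
Proof.
move=> [x Ex <-] [y Ey <-]; exists (x * y); first exact: EpM.
by apply/funext => v; rewrite !rmorphM.
Qed.

Lemma Hc_mul z w : Hc z -> Hc w -> Hc (fun v => z v * w v).
Proof. exact: (closure_mul alpha_Tk alpha_mul). Qed.

Lemma Hc_1 : Hc (fun=> 1).
Proof.
apply: subset_closure; exists 1; first exact: Ep1.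
by apply/funext => v; rewrite !rmorph1.
Qed.

Definition galois_product (mu : I -> int) (x : L) : L := \prod_v (sigma v x) ^ (mu v).

Lemma chi_alpha mu x : chi mu (alpha x) = iota (galois_product mu x).
Proof.
rewrite /chi /galois_product rmorph_prod; apply: eq_bigr => v _.
by rewrite /alpha /= fmorphXz.
Qed.

Lemma galois_product_neq0 mu x : x != 0 -> galois_product mu x != 0.
Proof. by move=> x0; apply/prodf_neq0 => v _; rewrite expfz_neq0 // fmorph_eq0. Qed.

Lemma galois_product_conj mu x : x * c x = 1 -> galois_product mu x * c (galois_product mu x) = 1.
Proof.
move=> xc; rewrite /galois_product rmorph_prod -big_split big1 //= => v _.
have -> : c (sigma v x ^ mu v) = c (sigma v x) ^ mu v by exact: gal_exprz.
by rewrite central -expfzMl -rmorphM xc rmorph1 exp1rz.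
Qed.

Lemma ord_galois_product mu x Q : finite_prime Q -> x != 0 ->
  ord Q (galois_product mu x) = \sum_v mu v * ord (gact (sigma v)^-1%g Q) x.
Proof.
move=> fQ x0; rewrite /galois_product ord_prod //; last first.
  by move=> v; rewrite expfz_neq0 // fmorph_eq0.
apply: eq_bigr => v _; rewrite ordXz ?fmorph_eq0 // mulrC; congr (_ * _).
rewrite -[Q in LHS](gact1 Q) -(mulVg (sigma v)) -gactM ord_gact //.
exact: finite_prime_gact.
Qed.

Lemma gact_inv_eq (g : G) P Q : gact (g^-1)%g Q = P <-> gact g P = Q.
Proof.
split=> <-; rewrite gactM ?mulVg ?mulgV gact1 //.
Qed.

(** [P'] differs from its conjugate, so the cases of [eps] exclude each other and leave a difference
    of indicators. Moving [sigma v] over to [P'] matches [ord_galois_product]. *)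
Lemma epsE P P' v : S P' -> eps sigma c P P' v =
  (`[< gact (sigma v)^-1%g P' = P >] : nat)%:Z - (`[< gact c (gact (sigma v)^-1%g P') = P >] : nat)%:Z.
Proof.
move=> SP'; have [_ cP'] := S_over SP'.
have e1 : `[< gact (sigma v)^-1%g P' = P >] = `[< gact (sigma v) P = P' >].
  by apply: asbool_equiv_eq; exact: gact_inv_eq.
have e2 : `[< gact c (gact (sigma v)^-1%g P') = P >] = `[< gact (sigma v) P = gact c P' >].
  apply: asbool_equiv_eq; rewrite gact_conj_comm; exact: gact_inv_eq.
rewrite e1 e2 /eps; case: asboolP => [e|_]; last by case: asboolP.
by rewrite e; case: asboolP => // /esym.
Qed.

(** The factor [h] is the valuation of the isolating element at [P]: only some power of [P] is known
    to be principal. *)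
Lemma prime_separating_unit P : S P -> exists x (h : int), [/\ Ep R p x, 0 < h &
  forall Q, finite_prime Q ->
    ord Q x = h * ((`[< Q = P >] : nat)%:Z - (`[< gact c Q = P >] : nat)%:Z)].
Proof.
move=> SP; have [pP cP] := S_over SP; have [fP Pp] := pP.
have [y [y0 h0 hy]] := isolating_element galL iota fP.
have cy0 : c y != 0 by rewrite fmorph_eq0.
exists (y / c y), (ord P y).
have ordx Q : finite_prime Q -> ord Q (y / c y) =
    ord P y * ((`[< Q = P >] : nat)%:Z - (`[< gact c Q = P >] : nat)%:Z).
  move=> fQ; rewrite ordM ?invr_eq0 // ordV //.
  have -> : ord Q (c y) = ord (gact c Q) y.
    by rewrite -{1}(gact_conjK Q) ord_gact //; exact: finite_prime_gact.
  have ordy Q' : finite_prime Q' -> ord Q' y = ord P y * (`[< Q' = P >] : nat)%:Z.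
    move=> fQ'; case: asboolP => [->|ne]; first by rewrite mulr1.
    by rewrite hy // mulr0.
  by rewrite mulrBr (ordy Q) // (ordy (gact c Q)) //; exact: finite_prime_gact.
split => //.
have x0 : y / c y != 0 by rewrite mulf_neq0 ?invr_eq0.
split => //.
  move=> Q fQ nQ; apply/(ord_unit galL fQ x0); rewrite ordx //.
  have /asboolF -> : Q <> P by move=> QP; apply: nQ; rewrite QP.
  have /asboolF -> : gact c Q <> P; last by rewrite subrr mulr0.
  by move=> QP; apply: nQ; move: Pp; rewrite -QP gactE rmorph_nat.
move=> tau; apply: norm_one_unimodular.
have -> : c (y / c y) = c y / y by rewrite fmorph_div /= conjK.
by rewrite mulrA divfK // divff.
Qed.

Definition eps_vec P P' : {ffun I -> int} := [ffun v => eps sigma c P P' v].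

(* The characters trivial on [alpha x] are orthogonal to every [eps_vec P P'],
   so Kronecker's theorem puts the whole one-parameter subgroup in the closure. *)
Lemma eps_line_mem P P' s : S P -> S P' -> Hc (texp (s *: int_vec R (eps_vec P P'))).
Proof.
move=> SP SP'; have [x [h [Ex h0 ordx]]] := prime_separating_unit SP.
have x0 := Ep_neq0 Ex; have [[fP' _] _] := S_over SP'.
apply/closure_boxP => e e0.
have [mu a1|n hn] := kronecker_approximation (alpha_Tk (alpha_mem Ex))
   (texp_Tk (s *: int_vec R (eps_vec P P'))) e0; last first.
  exists (alpha (x ^+ n)); first by apply: alpha_mem; exact: EpX.
  by move=> v; rewrite distrC /alpha !rmorphXn; exact: hn.
(* By injectivity of [iota] the resonance is an equality in [L], whose valuation at [P'] is [h]
   times the pairing of [mu] with [eps]. *)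
have u1 : galois_product mu x = 1.
  by apply: (fmorph_inj iota); rewrite -chi_alpha a1 rmorph1.
have : ord P' (galois_product mu x) = 0 by rewrite u1; exact: ord1.
rewrite ord_galois_product // => o0.
have s0 : \sum_v mu v * eps sigma c P P' v = 0.
  have : h * \sum_v mu v * eps sigma c P P' v = 0.
    rewrite mulr_sumr -[RHS]o0; apply: eq_bigr => v _.
    by rewrite ordx ?epsE //; [rewrite mulrCA | exact: finite_prime_gact].
  by move/eqP; rewrite mulf_eq0 gt_eqF //= => /eqP.
rewrite chi_texp_line.
rewrite int_vec_pairing; under eq_bigr => v _ do rewrite ffunE.
by rewrite s0 mulr0 cis0.
Qed.

(** All valuations vanish: away from [p] by definition of E_p, on [S] by orthogonality, on
    conjugates of [S] by antisymmetry, and at a self-conjugate prime because the valuation equals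
    its opposite. *)
Lemma unit_pairing_zero mu : (forall P P', S P -> S P' -> \sum_v mu v * eps sigma c P P' v = 0) ->
  forall x, Ep R p x -> integral (galois_product mu x).
Proof.
move=> hmu x Ex; have x0 := Ep_neq0 Ex; have xc := Ep_conj Ex.
have u0 := galois_product_neq0 mu x0; have uc := galois_product_conj mu xc.
apply: (unit_at_all_integral galL) => Q fQ; apply/(ord_unit galL fQ u0).
have [Qp|nQp] := pselect (Q p%:R); last first.
  rewrite ord_galois_product // big1 // => v _.
  have [_ ux _] := Ex; have fQ' := finite_prime_gact (sigma v)^-1%g fQ.
  suff -> : ord (gact (sigma v)^-1%g Q) x = 0 by rewrite mulr0.
  by apply/(ord_unit galL fQ' x0); apply: ux => //; rewrite gactE rmorph_nat.
have inS P' : S P' -> ord P' (galois_product mu x) = 0.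
  move=> SP'; have [pP' cP'] := S_over SP'; have [fP' _] := pP'.
  rewrite ord_galois_product //.
  pose q v := gact (sigma v)^-1%g P'.
  have pq v : prime_over p (q v) by exact: prime_over_gact.
  have cq v : gact c (q v) <> q v.
    rewrite /q gact_conj_comm => e; apply: cP'.
    by have := congr1 (gact (sigma v)) e; rewrite ![gact (sigma v) _]gactM mulVg !gact1.
  (* Either [q v] or its conjugate lies in [S]; exchanging them changes the sign of the valuation,
     which [w] absorbs. The sum of [w] over a fibre of [f] is then a pairing of [mu] with an
     [eps]. *)
  pose f v := if `[< S (q v) >] then q v else gact c (q v).
  pose w v : int := if `[< S (q v) >] then mu v else - mu v.
  have Sf v : S (f v).
    rewrite /f; case: asboolP => // nS.
    by apply: contrapT => /(S_repr (pq v) (cq v)).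
  rewrite (eq_bigr (fun v => w v * ord (f v) x)); last first.
    move=> v _; rewrite /w /f; case: asboolP => // _.
    by rewrite ord_conj // ?mulrNN //; case: (pq v).
  apply: (@grouped_sum I _ f w (fun P => ord P x)) => v0.
  have := hmu (f v0) P' (Sf v0) SP'; rewrite (bigID (fun v => `[< f v = f v0 >])) /=.
  rewrite [X in _ + X]big1 ?addr0; last first.
    move=> v /asboolP ne; rewrite epsE // -/(q v).
    have /asboolF -> : q v <> f v0.
      move=> e; apply: ne; rewrite /f; case: asboolP => // nS.
      by case: nS; rewrite e.
    have /asboolF -> : gact c (q v) <> f v0; last by rewrite subrr mulr0.
    move=> e; apply: ne; rewrite {1}/f; case: asboolP => // SQ.
    by have /(S_repr (pq v) (cq v)) := SQ; rewrite e.
  move=> e0; rewrite -[RHS]e0; apply: eq_bigr => v /asboolP e; rewrite epsE // -/(q v) -e /w /f.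
  case: asboolP => [SQ|nS].
    have /asboolT -> : q v = q v by [].
    by have /asboolF -> := cq v; rewrite subr0 mulr1.
  have /asboolF -> : q v <> gact c (q v) by exact: nesym.
  by have /asboolT -> : gact c (q v) = gact c (q v) by []; rewrite sub0r mulrN1.
have pQ : prime_over p Q by [].
have oc := ord_conj fQ u0 uc.
have [cQ|cQ] := pselect (gact c Q = Q).
  by move: oc; rewrite cQ; lia.
have [SQ|nSQ] := pselect (S Q); first exact: inS.
have ScQ : S (gact c Q) by apply: contrapT => /(S_repr pQ cQ).
by have := inS _ ScQ; rewrite oc; lia.
Qed.

(** The Galois products are integers with all conjugates of norm 1, killed by one common [N]; the
    resulting relation is a closed condition. *)
Lemma orthogonal_torsion mu :
  (forall P P', S P -> S P' -> \sum_v mu v * eps sigma c P P' v = 0) ->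
  exists2 N : nat, (0 < N)%N & forall z, Hc z -> chi (fun v => mu v * N%:Z) z = 1.
Proof.
move=> hmu; have [N N0 hN] := unimodular_torsion galL iota.
exists N => //; apply: (closure_chi1 alpha_Tk) => _ [x Ex <-].
transitivity (chi mu (alpha x) ^+ N).
  rewrite /chi -prodrXl; apply: eq_bigr => v _.
  by rewrite -exprz_exp exprnP.
rewrite chi_alpha -rmorphXn hN ?rmorph1 //; first exact: unit_pairing_zero.
by move=> g; apply: (norm_one_unimodular (iota \o g)); exact: galois_product_conj (Ep_conj Ex).
Qed.

Lemma line_mem_H0 P P' s : S P -> S P' ->
  connected_component Hc (fun=> 1) (texp (s *: int_vec R (eps_vec P P'))).
Proof.
move=> SP SP'; exists [set texp (s *: int_vec R (eps_vec P P')) | s in [set: R]]; last by exists s.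
split.
- by exists 0 => //; rewrite scale0r texp0.
- by move=> _ [s' _ <-]; exact: eps_line_mem.
- exact: connected_texp_line.
Qed.

Lemma dual_of_component mu :
  (forall z, connected_component Hc (fun=> 1) z -> chi mu z = 1) <->
  (forall P P', S P -> S P' -> \sum_v mu v * eps sigma c P P' v = 0).
Proof.
split=> [h P P' SP SP'|hmu z [C [C1 CH cC] Cz]].
  have /chi_texp_line_trivial : forall s, chi mu (texp (s *: int_vec R (eps_vec P P'))) = 1.
    by move=> s; apply: h; exact: line_mem_H0.
  rewrite int_vec_pairing => /eqP; rewrite intr_eq0 => /eqP e0.
  by rewrite -[RHS]e0; apply: eq_bigr => v _; rewrite ffunE.
have [N N0 hN] := orthogonal_torsion hmu.
have HT := closure_Tk alpha_Tk.
have N1 : 0 < (N%:R)^-1 :> R[i] by rewrite invr_gt0 ltr0n.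
(* On [Hc] the values of [chi mu] are [N]-th roots of unity, and two of them closer than [1 / N]
   coincide: [chi mu] is locally constant with the uniform radius [d]. *)
have [d d0 hd] := dist_chi_lt mu N1.
rewrite (connected_locally_constant (f := chi mu) cC d0 _ Cz C1).
  by rewrite /chi big1 // => v _; rewrite exp1rz.
move=> z1 z2 /CH H1 /CH H2 near12.
have T1 := HT _ H1; have T2 := HT _ H2.
have n1 := chi_norm mu T1; have n2 := chi_norm mu T2.
have chiN z' : Hc z' -> chi mu z' ^+ N = 1.
  move=> Hz'; rewrite -(hN z' Hz') /chi -prodrXl; apply: eq_bigr => v _.
  by rewrite -exprz_exp exprnP.
have c20 : chi mu z2 != 0 by rewrite -normr_eq0 n2 oner_eq0.
suff e1 : chi mu z1 / chi mu z2 = 1 by rewrite -(divfK c20 (chi mu z1)) e1 mul1r.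
apply: (root_of_unity_gap N0).
- by rewrite normrM normfV n1 n2 divr1.
- by rewrite expr_div_n !chiN // divr1.
- have -> : chi mu z1 / chi mu z2 - 1 = (chi mu z1 - chi mu z2) / chi mu z2.
    by rewrite mulrBl divff.
  by rewrite normrM normfV n2 invr1 mulr1 -ltr_pdivlMr ?ltr0n // div1r; exact: hd.
Qed.

(** * The Lie algebra of the closure *)

Lemma texp_span_mem (s : seq {ffun I -> R^o}) t :
  (forall e, e \in s -> forall r : R, Hc (texp (r *: e))) ->
  t \in <<s>>%VS -> forall r : R, Hc (texp (r *: t)).
Proof.
move=> hs ts; rewrite (coord_span (X := in_tuple s) ts).
elim/big_ind: _ => [r|a b ha hb r|i _ r].
- by rewrite scaler0 texp0; exact: Hc_1.
- by rewrite scalerDr texpD; apply: Hc_mul.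
- by rewrite scalerA; apply: hs; rewrite mem_nth //; case: i.
Qed.

Lemma orthogonal_span (s : seq {ffun I -> int}) mu e :
  (forall f, f \in s -> \sum_v mu v * f v = 0) ->
  int_vec rat e \in <<map (int_vec rat) s>>%VS -> \sum_v mu v * e v = 0.
Proof.
move=> hs /(coord_span (X := in_tuple (map (int_vec rat) s))) eE.
apply/eqP; rewrite -(intr_eq0 rat) -int_vec_pairing eE; apply/eqP.
under eq_bigr => v _ do rewrite sum_ffunE mulrz_suml.
rewrite exchange_big big1 //= => i _.
have : (map (int_vec rat) s)`_i \in map (int_vec rat) s by rewrite mem_nth //; case: i.
move=> /mapP[f fs ->].
under eq_bigr => v _ do rewrite ffunE -mulrzAr.
by rewrite -mulr_sumr int_vec_pairing hs // mulr0.
Qed.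

Lemma dim_closure : exists d : nat, subgroup_dim Hc d /\
  qspan_dim [set e : {ffun I -> rat^o} | exists P P',
     [/\ S P, S P' & e = [ffun v => (eps sigma c P P' v)%:~R]]] d.
Proof.
have vecE (F : fieldType) P P' : [ffun v => (eps sigma c P P' v)%:~R] = int_vec F (eps_vec P P').
  by apply/ffunP => v; rewrite !ffunE.
set X := (X in qspan_dim X).
have [s [sX fs spanX]] := maximal_free_seq X.
(* The rational basis is lifted to integer vectors, so that the same family can be read over [R]. *)
have [s0 s0E hs0] : exists2 s0 : seq {ffun I -> int}, map (int_vec rat) s0 = s &
    forall f, f \in s0 -> exists P P', [/\ S P, S P' & f = eps_vec P P'].
  apply: (lift_seq (Q := fun f => exists P P', [/\ S P, S P' & f = eps_vec P P'])) => x /sX[P [P' [SP SP' ->]]].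
  by exists (eps_vec P P'); [exists P, P' | rewrite vecE].
pose s1 := in_tuple s0.
have fR : free (map (int_vec R) s0) by apply: (@free_int_vec_extend I R _ s1); rewrite s0E.
exists (size s0); split; last first.
  by exists s; split => //; rewrite (eqP fs) -s0E size_map.
exists <<map (int_vec R) s0>>%VS; split; last by rewrite (eqP fR) size_map.
move=> t; split=> [ts r|ht].
  apply: texp_span_mem ts r => e /mapP[f /hs0[P [P' [SP SP' ->]]] ->] r.
  exact: eps_line_mem.
(* An integer vector orthogonal to the basis is orthogonal to every eps; a multiple of it is trivial
   on [Hc] and so kills the tangent vector [t]. *)
apply: (@integer_orthogonal_span I R _ s1) => mu hmu.
have [N N0 hN] : exists2 N : nat, (0 < N)%N & forall z, Hc z -> chi (fun v => mu v * N%:Z) z = 1.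
  apply: orthogonal_torsion => P P' SP SP'.
  have : int_vec rat (eps_vec P P') \in <<map (int_vec rat) s0>>%VS.
    by rewrite s0E; apply: spanX; exists P, P'; rewrite vecE.
  move=> /(orthogonal_span hmu) e0; rewrite -[RHS]e0; by apply: eq_bigr => v _; rewrite ffunE.
have /chi_texp_line_trivial/eqP : forall r, chi (fun v => mu v * N%:Z) (texp (r *: t)) = 1.
  by move=> r; apply: hN; exact: ht.
under eq_bigr => v _ do rewrite mulrzA.
rewrite -mulrz_suml mulrz_eq0 eqz_nat -leqn0 leqNgt N0 /= => /eqP.
by [].
Qed.

(** The primes over [p] are as numerous as the elements of the group, so the injective choice [k] of
    an element carrying [P] to each of them is a bijection. *)
Lemma decomposed_free P (g h : G) : completely_decomposed L p -> prime_over p P ->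
  gact g P = gact h P -> g = h.
Proof.
move=> [f [finj fover fall]] pP gh.
have cardG : #|{: G}| = \dim {:L}.
  have := galois_dim galL; rewrite dimv1 divn1 => ->; apply: eq_card => k.
  by rewrite gal_kHom ?sub1v // k1AHom.
have [k kE] := choice (fun i => primes_over_transitive galL p_prime iota pP (fover i)).
have kinj : injective k by move=> i j e; apply: finj; rewrite !kE e.
have [k' kK k'K] : bijective k by apply: inj_card_bij => //; rewrite cardG card_ord.
rewrite -(k'K g) -(k'K h); congr k; apply: finj.
by rewrite !kE !k'K.
Qed.

Hypothesis sigma_repr : forall g : G, exists! v : I,
  g = sigma v \/ (forall a, g a = c (sigma v a)).

Lemma decomposed_dense : completely_decomposed L p -> Hc = @Tk R I.
Proof.
move=> dec; have [f [_ fover _]] := dec.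
have free P (g h : G) : prime_over p P -> gact g P = gact h P -> g = h.
  by move=> pP; exact: decomposed_free.
have c1 : c <> 1%g.
  by have [x /eqP cx] := conj_neq1 CM c_conj; move=> c1; apply: cx; rewrite c1 gal1f.
have cP P : prime_over p P -> gact c P <> P.
  by move=> pP; rewrite -{2}(gact1 P) => /(free _ _ _ pP).
have [P SP] : exists P, S P.
  have dim0 : (0 < \dim {:L})%N by rewrite adim_gt0.
  pose P := f (Ordinal dim0); have pP : prime_over p P by exact: fover.
  have [SP|nSP] := pselect (S P); [by exists P | exists (gact c P)].
  by apply: contrapT => /(S_repr pP (cP _ pP)).
have [pP _] := S_over SP.
(* By freeness, an equality would make [sigma v'] equal to [sigma v] or to its conjugate, and the
   two places would coincide. *)
have distinct v v' : v <> v' -> gact (sigma v') P <> gact (sigma v) P /\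
    gact (sigma v') P <> gact c (gact (sigma v) P).
  move=> vv'; have [u [_ uniq]] := sigma_repr (sigma v').
  have uv' : u = v' by apply: uniq; left.
  split; first by move=> /(free _ _ _ pP) e; apply: vv'; rewrite -uv'; apply/esym/uniq; left.
  rewrite gactM => /(free _ _ _ pP) e; apply: vv'; rewrite -uv'; apply/esym/uniq; right.
  by move=> a; rewrite e galMf.
(* [P'] is whichever of the image of [P] under [sigma v] and its conjugate lies in [S], and [k] is
   the resulting sign. The eps with this fixed [P] thus contain all coordinate vectors up to sign,
   and their lines generate the torus. *)
have single v : exists P' (k : int), S P' /\ forall v', k * eps sigma c P P' v' = (v == v')%:Z.
  pose Q := gact (sigma v) P; have pQ : prime_over p Q by exact: prime_over_gact.
  have [SQ|nSQ] := pselect (S Q).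
    exists Q, 1; split => // v'; rewrite mul1r /eps.
    have [<-|/eqP vv'] := eqVneq v v'; first by rewrite asboolT.
    by have [n1 n2] := distinct v v' vv'; rewrite !asboolF.
  exists (gact c Q), (-1); split.
    by apply: contrapT => /(S_repr pQ (cP _ pQ)).
  move=> v'; rewrite /eps gact_conjK.
  have [<-|/eqP vv'] := eqVneq v v'.
    by rewrite asboolF ?asboolT ?mulrNN ?mulr1 //; exact: nesym (cP _ pQ).
  by have [n1 n2] := distinct v v' vv'; rewrite !asboolF // mulr0.
apply/seteqP; split; first exact: closure_Tk alpha_Tk.
move=> z z1.
have [th thE] := choice (fun v => cis_surj (z1 v)).
pose t : {ffun I -> R^o} := [ffun v => th v].
have -> : z = texp t by apply/funext => v; rewrite texpE ffunE.
have [P' hP'] := choice single.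
have [k hk] := choice hP'.
have -> : t = \sum_v (th v * (k v)%:~R) *: int_vec R (eps_vec P (P' v)).
  apply/ffunP => v'; rewrite sum_ffunE ffunE (bigD1 v') //= big1 ?addr0.
    have [_ /(_ v')] := hk v'; rewrite eqxx => /(congr1 (intmul (1 : R))).
    by rewrite intrM !ffunE -[_ *: _]mulrA => ->; rewrite mulr1.
  move=> v ne; have [_ /(_ v')] := hk v; rewrite (negPf ne) => /(congr1 (intmul (1 : R))).
  by rewrite intrM !ffunE -[_ *: _]mulrA => ->; rewrite mulr0.
elim/big_ind: _ => [|a b ha hb|v _].
- by rewrite texp0; exact: Hc_1.
- by rewrite texpD; exact: Hc_mul.
- by apply: eps_line_mem => //; case: (hk v).
Qed.
End Main.

Theorem theorem4p1
  (R : realType) (L : splittingFieldType rat) (p : nat)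
  (iota : {rmorphism L -> R[i]})
  (I : finType) (sigma : I -> gal_of {:L}) (c : gal_of {:L})
  (S : set (set L)) :
  galois 1%VS {:L} ->
  is_CM L R ->
  prime p ->
  (* c is complex conjugation on k *)
  (forall x, iota (c x) = (iota x)^*) ->
  (* I indexes the infinite places: v is the place induced by iota o sigma_v,
     and every embedding iota o g induces exactly one of them *)
  (forall g : gal_of {:L}, exists! v : I,
      g = sigma v \/ (forall a, g a = c (sigma v a))) ->
  (* S is a system of representatives of T under complex conjugation *)
  (forall P, S P -> prime_over p P /\ gact c P <> P) ->
  (forall P, prime_over p P -> gact c P <> P -> (S P <-> ~ S (gact c P))) ->
  let H := closure (alpha_img iota sigma p) in
  let H0 := connected_component H (fun _ => 1) in
  [/\ (forall mu : I -> int,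
         (forall z, H0 z -> chi mu z = 1) <->
         (forall P P', S P -> S P' -> \sum_v mu v * eps sigma c P P' v = 0)),
      exists d : nat,
        subgroup_dim H d /\
        qspan_dim
          [set e : {ffun I -> rat^o} | exists P P',
             [/\ S P, S P' & e = [ffun v => (eps sigma c P P' v)%:~R]]] d &
      completely_decomposed L p -> H = @Tk R I].
Proof.
move=> galL CM p_prime c_conj sigma_repr S_over S_repr H H0; split.
- by move=> mu; exact: dual_of_component.
- exact: dim_closure.
- exact: (decomposed_dense galL CM p_prime c_conj S_over S_repr sigma_repr).
Qed.
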